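(* Let $H$ be a separable Hilbert space, let $(X_t)_{t\geq 1}$ be $H$-valued and $(\epsilon_t)_{t\geq1}$ real-valued, and $(\mathcal{F}_t)_{t\geq 0}$ a filtration such that for all $t\ge1$: $X_t$ is $\mathcal{F}_{t-1}$-measurable, $\epsilon_t$ is $\mathcal{F}_t$-measurable, $\mathbb{E}[\epsilon_t\mid\mathcal{F}_{t-1}]=0$, $|\epsilon_t|\le B$, and $\mathrm{Var}(\epsilon_t\mid\mathcal{F}_{t-1})\le\sigma_t^2$ with $\sigma_t$ $\mathcal{F}_{t-1}$-measurable. Fix $\rho>0$ and set $V_t=\sum_{i\leq t}X_iX_i^T$, $M_t=\sum_{i\le t}X_i\epsilon_i$, $G_t=(\rho I+V_t)^{-1/2}X_t$, $$s_t=\|(\rho I+V_t)^{-1/2}M_t\|,\qquad \nu_t=\sum_{i\le t}\sigma_i^2\|G_i\|^2.$$ Then for every $\theta>0$ and $\delta\in(0,1)$, $$\mathbb{P}\left(\sup_t \frac{(\theta/B^2)^{\theta/B^2}}{\Gamma(\theta/B^2)\,\overline{\gamma}(\theta/B^2,\theta/B^2)}\cdot\frac{\Gamma\big(\frac{Bs_t+\nu_t+\theta}{B^2}\big)\,\overline{\gamma}\big(\frac{Bs_t+\nu_t+\theta}{B^2},\frac{\nu_t+\theta}{B^2}\big)}{\big(\frac{\nu_t+\theta}{B^2}\big)^{\frac{Bs_t+\nu_t+\theta}{B^2}}}\exp\Big(\frac{\nu_t}{B^2}\Big)<\frac{2}{\delta}\right)\ge1-\delta,$$ where $\overline{\gamma}(a,x)=\frac{1}{\Gamma(a)}\int_x^\infty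 u^{a-1}e^{-u}\,du$ is the regularized upper incomplete gamma function.
   Context: For $f,g\in H$, $fg^T$ denotes the operator $f\langle g,\cdot\rangle$ on $H$, and $I$ is the identity operator on $H$. *)

(* Defs.v *)
From HB Require Import structures.
From Stdlib Require Import ClassicalEpsilon.
From mathcomp Require Import all_boot all_order all_algebra.
From mathcomp Require Import all_classical all_reals all_analysis.
Set Implicit Arguments. Unset Strict Implicit. Unset Printing Implicit Defensive.
Import Order.TTheory GRing.Theory Num.Theory.
Local Open Scope classical_set_scope.
Local Open Scope ring_scope.

Definition hnorm (R : realType) (H : lmodType R) (inner : H -> H -> R) (x : H) : R :=
  Num.sqrt (inner x x).

Definition is_separable_hilbert (R : realType) (H : lmodType R)
    (inner : H -> H -> R) : Prop :=
  [/\ (forall x y, inner x y = inner y x),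
      (forall a x y z, inner (a *: x + y) z = a * inner x z + inner y z),
      (forall x, 0 <= inner x x) /\ (forall x, inner x x = 0 -> x = 0),
      (forall u : nat -> H,
         (forall e : R, 0 < e -> exists N, forall m n, (N <= m)%N -> (N <= n)%N ->
              hnorm inner (u m - u n) < e) ->
         exists l : H, forall e : R, 0 < e -> exists N, forall n, (N <= n)%N ->
              hnorm inner (u n - l) < e)
    &
      (exists d : nat -> H, forall x (e : R), 0 < e -> exists n, hnorm inner (x - d n) < e)].

Definition is_inv_sqrt (R : realType) (H : lmodType R) (inner : H -> H -> R)
    (A S : H -> H) : Prop :=
  [/\ (forall a x y, S (a *: x + y) = a *: S x + S y),
      (forall x y, inner (S x) y = inner x (S y)),
      (forall x, 0 <= inner (S x) x),
      (forall x, S (S (A x)) = x)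
    & (forall x, A (S (S x)) = x)].

Definition inv_sqrt (R : realType) (H : lmodType R) (inner : H -> H -> R)
    (A : H -> H) : H -> H :=
  epsilon (inhabits (fun x : H => x)) (is_inv_sqrt inner A).

(* rho I + V_t (omega), V_t = sum_{1<=i<=t} X_i X_i^T, with (f g^T) x = f <g, x> *)
Definition regV (R : realType) (H : lmodType R) (inner : H -> H -> R)
    (rho : R) (X : nat -> H) (t : nat) : H -> H :=
  fun x => rho *: x + \sum_(1 <= i < t.+1) inner (X i) x *: X i.

Definition Mt (R : realType) (H : lmodType R) (X : nat -> H) (eps : nat -> R) (t : nat) : H :=
  \sum_(1 <= i < t.+1) eps i *: X i.

Definition s_t (R : realType) (H : lmodType R) (inner : H -> H -> R)
    (rho : R) (X : nat -> H) (eps : nat -> R) (t : nat) : R :=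
  hnorm inner (inv_sqrt inner (regV inner rho X t) (Mt X eps t)).

Definition G_t (R : realType) (H : lmodType R) (inner : H -> H -> R)
    (rho : R) (X : nat -> H) (t : nat) : H :=
  inv_sqrt inner (regV inner rho X t) (X t).

Definition nu_t (R : realType) (H : lmodType R) (inner : H -> H -> R)
    (rho : R) (X : nat -> H) (sigma : nat -> R) (t : nat) : R :=
  \sum_(1 <= i < t.+1) sigma i ^+ 2 * hnorm inner (G_t inner rho X i) ^+ 2.

Definition Gamma_fn (R : realType) (a : R) : R :=
  (\int[lebesgue_measure]_(u in [set u : R | 0 < u]) (u `^ (a - 1) * expR (- u)))%R.

Definition upper_gamma (R : realType) (a x : R) : R :=
  (\int[lebesgue_measure]_(u in [set u : R | x <= u]) (u `^ (a - 1) * expR (- u)))%R.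

Definition reg_upper_gamma (R : realType) (a x : R) : R :=
  upper_gamma a x / Gamma_fn a.

Definition measurable_wrt (d : measure_display) (T : measurableType d) (R : realType)
    (G : set_system T) (f : T -> R) : Prop :=
  forall B : set R, measurable B -> G (f @^-1` B).

Definition filtration (d : measure_display) (T : measurableType d)
    (F : nat -> set_system T) : Prop :=
  [/\ (forall t, sigma_algebra setT (F t)),
      (forall t, F t `<=` measurable)
    & (forall s t, (s <= t)%N -> F s `<=` F t)].

Definition condexp_version (d : measure_display) (T : measurableType d) (R : realType)
    (P : probability T R) (G : set_system T) (f Z : T -> R) : Prop :=
  [/\ measurable_wrt G Z,
      P.-integrable setT (EFin \o f),
      P.-integrable setT (EFin \o Z)
    & (forall A, G A ->
        (\int[P]_(w in A) (Z w)%:E = \int[P]_(w in A) (f w)%:E)%E)].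

Definition condexp_zero (d : measure_display) (T : measurableType d) (R : realType)
    (P : probability T R) (G : set_system T) (f : T -> R) : Prop :=
  condexp_version P G f (fun=> 0).

Definition condvar_le (d : measure_display) (T : measurableType d) (R : realType)
    (P : probability T R) (G : set_system T) (f s : T -> R) : Prop :=
  exists Z1 Z2 : T -> R,
    [/\ condexp_version P G f Z1,
        condexp_version P G (fun w => f w ^+ 2) Z2
      & {ae P, forall w, Z2 w - Z1 w ^+ 2 <= s w ^+ 2}].

(* H-valued X is G-measurable (weakly, equivalent by Pettis for separable H) *)
Definition Hmeasurable_wrt (d : measure_display) (T : measurableType d) (R : realType)
    (H : lmodType R) (inner : H -> H -> R) (G : set_system T) (X : T -> H) : Prop :=
  forall h : H, measurable_wrt G (fun w => inner h (X w)).

(* Main.v *)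
Require Import Defs.
From Stdlib Require Import ClassicalEpsilon.
From mathcomp Require Import all_boot all_order all_algebra.
From mathcomp Require Import ring lra.
From mathcomp Require Import all_classical all_reals all_analysis.
From mathcomp Require Import measurable_realfun.
Set Implicit Arguments. Unset Strict Implicit. Unset Printing Implicit Defensive.
Import Order.TTheory GRing.Theory Num.Theory.
Import numFieldNormedType.Exports.
Local Open Scope classical_set_scope.
Local Open Scope ring_scope.

(* For fixed [lam >= 0] let [psi = (exp (lam B) - 1 - lam B) / B^2]. Then
   [s_t = |y + eps_t G_t|] with [y = (rho I + V_t)^(-1/2) M_{t-1}] predictable,
   and [|y| <= s_{t-1}] because [rho I + V_t] increases with [t]. A pathwise
   form of Pinelis' inequality bounds [cosh (lam s_t)] by
   [cosh (lam |y|) (1 + eps_t^2 |G_t|^2 psi)] plus a predictable multiple of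
   [eps_t]. Hence [cosh (lam s_t) exp (- nu_t psi)] is a supermartingale.
   Mixing it over [lam] with density proportional to [exp (- theta psi)] keeps
   this property, and Ville's inequality applies to the mixture. The
   substitution [u = (nu_t + theta) / B^2 * exp (lam B)] identifies the mixture
   of [exp (lam s_t - nu_t psi)] with the incomplete gamma expression, and
   [exp <= 2 cosh] accounts for the factor 2.

   The epsilon-chosen inverse square root enters only through
   [x |-> <x, (rho I + V_t)^-1 x>], which the Sherman-Morrison recursion makes
   explicit and measurable. *)

(** No conditional expectation operator is used. The supermartingale property is an inequality
    between integrals over events of [F t], or against bounded non-negative [F t]-measurable
    weights; replacing [eps_t^2] by [sigma_t^2] under a predictable factor is a layer-cake argument
    on that factor. Since [sigma_t] is not assumed bounded, the integrals involved may be infinite,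
    so all estimates are kept between non-negative functions; the one signed term, linear in
    [eps_t], is made non-negative by adding a bounded multiple of its coefficient.

    [G_t] is built from [rho I + V_t], which already contains [X_t]. Because [X_t] is predictable,
    [G_t] still is, and in exchange [|G_t| <= 1]. Hence [|eps_t G_t| <= B], which is why [psi]
    depends on [B] alone and not on the size of [X_t].

    The mixture runs over the scalar [lam] only, through [cosh] of a norm, so the dimension of [H]
    never enters. *)

(** * Positive semidefinite forms and their seminorms *)

Section psd_form.
Variables (R : realType) (H : lmodType R).

(** Semidefinite, so that the same lemmas serve [inner], the forms [qform] and the possibly
    degenerate form [inner (K x) y] of an operator [K]. *)
Definition psd_form (q : H -> H -> R) : Prop :=
  [/\ forall x y, q x y = q y x,
      forall a x y z, q (a *: x + y) z = a * q x z + q y z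
    & forall x, 0 <= q x x].

Variable q : H -> H -> R.
Hypothesis qP : psd_form q.

Lemma formC x y : q x y = q y x. Proof. by case: qP. Qed.

Lemma form_ge0 x : 0 <= q x x. Proof. by case: qP. Qed.

Lemma formDl x y z : q (x + y) z = q x z + q y z.
Proof. by case: qP => _ lin _; rewrite -[x]scale1r lin mul1r scale1r. Qed.

Lemma form0l z : q 0 z = 0.
Proof. by apply: (addrI (q 0 z)); rewrite -formDl !addr0. Qed.

Lemma formZl a x z : q (a *: x) z = a * q x z.
Proof. by case: qP => _ lin _; rewrite -[a *: x]addr0 lin form0l addr0. Qed.

Lemma formNl x z : q (- x) z = - q x z.
Proof. by rewrite -scaleN1r formZl mulN1r. Qed.

Lemma formBl x y z : q (x - y) z = q x z - q y z.
Proof. by rewrite formDl formNl. Qed.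

Lemma form0r z : q z 0 = 0. Proof. by rewrite formC form0l. Qed.

Lemma formDr x y z : q x (y + z) = q x y + q x z.
Proof. by rewrite formC formDl !(formC _ x). Qed.

Lemma formZr a x z : q z (a *: x) = a * q z x.
Proof. by rewrite formC formZl formC. Qed.

Lemma formNr x z : q z (- x) = - q z x.
Proof. by rewrite formC formNl formC. Qed.

Lemma formBr x y z : q x (y - z) = q x y - q x z.
Proof. by rewrite formDr formNr. Qed.

Definition formE :=
  (formDl, formDr, formBl, formBr, formZl, formZr, formNl, formNr, form0l, form0r).

Lemma form_sumr (I : Type) (r : seq I) (f : I -> H) z :
  q z (\sum_(i <- r) f i) = \sum_(i <- r) q z (f i).
Proof. by elim/big_rec2: _ => [|i y1 y2 _ <-]; rewrite ?form0r ?formDr. Qed.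

Lemma form_cauchy_schwarz x y : q x y ^+ 2 <= q x x * q y y.
Proof.
have [xx0|xx0] := eqVneq (q x x) 0.
  have [->|xy0] := eqVneq (q x y) 0; first by rewrite xx0 mul0r expr0n.
  (* When [q x x = 0], the form at [t x + y] is affine in [t], and this [t] brings it down to
     [-1]. *)
  have := form_ge0 ((- (q y y + 1) / (2 * q x y)) *: x + y).
  suff -> : q ((- (q y y + 1) / (2 * q x y)) *: x + y)
    ((- (q y y + 1) / (2 * q x y)) *: x + y) = -1 by rewrite ler0N1.
  by rewrite !formE xx0 (formC y x); field.
(* This vector is [q x x] times the component of [y] orthogonal to [x]. *)
have := form_ge0 (q x x *: y - q x y *: x).
have -> : q (q x x *: y - q x y *: x) (q x x *: y - q x y *: x) =
  q x x * (q x x * q y y - q x y ^+ 2) by rewrite !formE (formC y x); ring.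
by rewrite pmulr_rge0 ?subr_ge0// lt_def xx0 form_ge0.
Qed.

Lemma hnorm_ge0 x : 0 <= hnorm q x. Proof. exact: sqrtr_ge0. Qed.

Lemma sqr_hnorm x : hnorm q x ^+ 2 = q x x.
Proof. by rewrite sqr_sqrtr// form_ge0. Qed.

Lemma normr_form_le x y : `|q x y| <= hnorm q x * hnorm q y.
Proof.
rewrite -(@ler_pXn2r _ 2)// ?nnegrE ?mulr_ge0 ?hnorm_ge0//.
by rewrite real_normK ?num_real// exprMn !sqr_hnorm form_cauchy_schwarz.
Qed.

Lemma hnormD x y : hnorm q (x + y) <= hnorm q x + hnorm q y.
Proof.
rewrite -(@ler_pXn2r _ 2)// ?nnegrE ?addr_ge0 ?hnorm_ge0//.
rewrite sqr_hnorm sqrrD !sqr_hnorm !formE (formC y x).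
have := normr_form_le x y; rewrite ler_norml => /andP[_]; lra.
Qed.

Lemma hnormN x : hnorm q (- x) = hnorm q x.
Proof. by rewrite /hnorm !formE opprK. Qed.

Lemma hnormB x y : hnorm q (x - y) = hnorm q (y - x).
Proof. by rewrite -hnormN opprB. Qed.

Lemma hnormZ a x : hnorm q (a *: x) = `|a| * hnorm q x.
Proof. by rewrite /hnorm !formE mulrA -expr2 sqrtrM ?sqr_ge0// sqrtr_sqr. Qed.

Lemma hnorm0 : hnorm q 0 = 0.
Proof. by rewrite /hnorm form0l sqrtr0. Qed.

End psd_form.

(** * Norm convergence in the Hilbert space *)

Section hilbert.
Variables (R : realType) (H : lmodType R) (inner : H -> H -> R).
Hypothesis hH : is_separable_hilbert inner.

Local Notation norm := (hnorm inner).

Lemma inner_psd : psd_form inner. Proof. by case: hH => ? ? []. Qed.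

Let iP := inner_psd.

Lemma hnorm_eq0 x : norm x = 0 -> x = 0.
Proof.
case: hH => _ _ [_ def] _ _ x0; apply: def.
by rewrite -(sqr_hnorm iP) x0 expr0n.
Qed.

(** Phrased through the real sequence of distances, because [H] is a bare module without a
    topology. *)
Definition hcvg (u : nat -> H) (l : H) := norm (u n - l) @[n --> \oo] --> (0 : R).

Lemma hcvg_squeeze (u : nat -> H) (l : H) (b : nat -> R) :
  (forall n, norm (u n - l) <= b n) -> b n @[n --> \oo] --> (0 : R) -> hcvg u l.
Proof.
move=> ub b0; apply: (squeeze_cvgr _ (cvg_cst 0) b0).
by near=> n; rewrite ub andbT hnorm_ge0.
Unshelve. all: by end_near. Qed.

Lemma hcvg_unique u l l' : hcvg u l -> hcvg u l' -> l = l'.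
Proof.
move=> ul ul'; apply/eqP; rewrite -subr_eq0; apply/eqP/hnorm_eq0.
have lim0 : norm (u n - l) + norm (u n - l') @[n --> \oo] --> (0 : R).
  by rewrite -[0 : R]addr0; exact: cvgD.
apply/eqP; rewrite eq_le hnorm_ge0 andbT.
apply: (cvgr_to_ge lim0).
near=> n; rewrite (hnormB iP (u n) l).
by apply: le_trans (hnormD iP _ _); rewrite addrA subrK.
Unshelve. all: by end_near. Qed.

Lemma hcvgD u v l m : hcvg u l -> hcvg v m -> hcvg (fun n => u n + v n) (l + m).
Proof.
move=> ul vm.
apply: (@hcvg_squeeze _ _ (fun n => norm (u n - l) + norm (v n - m))).
  by move=> n; rewrite opprD addrACA hnormD.
by rewrite -[0 : R]addr0; exact: cvgD.
Qed.

Lemma hcvgZ a u l : hcvg u l -> hcvg (fun n => a *: u n) (a *: l).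
Proof.
move=> ul; apply: (@hcvg_squeeze _ _ (fun n => `|a| * norm (u n - l))).
  by move=> n; rewrite -scalerBr hnormZ.
by rewrite -(mulr0 `|a|); apply: cvgM => //; exact: cvg_cst.
Qed.

Lemma hcvg_cst l : hcvg (fun=> l) l.
Proof. by rewrite /hcvg subrr hnorm0//; exact: cvg_cst. Qed.

Lemma hcvg_innerl (y : H) u l : hcvg u l -> inner (u n) y @[n --> \oo] --> inner l y.
Proof.
move=> ul; apply/subr_cvg0/norm_cvg0P.
have lim0 : norm (u n - l) * norm y @[n --> \oo] --> (0 : R).
  by rewrite -(mul0r (norm y)); apply: cvgM => //; exact: cvg_cst.
apply: (squeeze_cvgr _ (cvg_cst 0) lim0).
by near=> n; rewrite normr_ge0 /= -(formBl iP) normr_form_le.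
Unshelve. all: by end_near. Qed.

Lemma hcvg_norm_le u l c : hcvg u l -> (forall n, norm (u n) <= c) -> norm l <= c.
Proof.
move=> ul uc; rewrite -[leRHS]add0r.
have lim0 : norm (u n - l) + c @[n --> \oo] --> 0 + c.
  by apply: cvgD => //; exact: cvg_cst.
apply: (cvgr_to_ge lim0).
near=> n; rewrite -[X in norm X <= _](subrK (u n)) (hnormB iP (u n) l).
by apply: le_trans (hnormD iP _ _) _; rewrite lerD2l.
Unshelve. all: by end_near. Qed.

Lemma hilbert_complete (u : nat -> H) (k c : R) : 0 <= k < 1 ->
  (forall m n, norm (u (n + m)%N - u n) <= k ^+ n * c) -> exists l, hcvg u l.
Proof.
move=> /andP[k0 k1] ukc.
have k0c : k ^+ n * c @[n --> \oo] --> (0 : R).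
  rewrite -(mul0r c); apply: cvgM; last exact: cvg_cst.
  by apply: cvg_expr; rewrite ger0_norm.
case: hH => _ _ _ compl _.
have /compl[l ul] : forall e : R, 0 < e -> exists N, forall m n, (N <= m)%N -> (N <= n)%N ->
              norm (u m - u n) < e.
  move=> e e0; have /cvgrPdist_lt /(_ _ e0)[N _ Ne] := k0c.
  have small m n : (N <= n <= m)%N -> norm (u m - u n) < e.
    move=> /andP[Nn nm]; rewrite -(subnKC nm); apply: le_lt_trans (ukc _ _) _.
    by have := Ne n Nn; rewrite /= sub0r normrN; exact/le_lt_trans/ler_norm.
  exists N => m n Nm Nn; case: (leqP n m) => [nm|/ltnW mn].
    by rewrite small// Nn.
  by rewrite (hnormB iP) small// Nm.
exists l; apply/cvgrPdist_lt => e e0; have [N Ne] := ul _ e0.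
by exists N => // n /Ne; rewrite /= sub0r normrN ger0_norm// hnorm_ge0.
Qed.

End hilbert.

(** * Existence of inverse square roots of bounded coercive operators *)

Section operator_sqrt.
Variables (R : realType) (H : lmodType R) (inner : H -> H -> R).
Hypothesis hH : is_separable_hilbert inner.
Local Notation norm := (hnorm inner).

Let iP := inner_psd hH.

Definition oplinear (A : H -> H) := forall a x y, A (a *: x + y) = a *: A x + A y.
Definition opsym (A : H -> H) := forall x y, inner (A x) y = inner x (A y).

Section oplinear_theory.
Variable A : H -> H.
Hypothesis lA : oplinear A.

Lemma oplinearD x y : A (x + y) = A x + A y.
Proof. by rewrite -{1}[x]scale1r lA scale1r. Qed.

Lemma oplinear0 : A 0 = 0.
Proof. by apply: (addrI (A 0)); rewrite -oplinearD !addr0. Qed.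

Lemma oplinearZ a x : A (a *: x) = a *: A x.
Proof. by rewrite -[a *: x]addr0 lA oplinear0 addr0. Qed.

Lemma oplinearB x y : A (x - y) = A x - A y.
Proof. by rewrite oplinearD -scaleN1r oplinearZ scaleN1r. Qed.

End oplinear_theory.

Section fixed_point.
Variables (K : H -> H) (k : R).
Hypotheses (lK : oplinear K) (sK : opsym K) (k01 : 0 <= k < 1).
Hypothesis bK : forall x, norm (K x) <= k * norm x.

(** Fixed-point iteration from 0 for [2 Y = K + Y^2], that is [(1 - Y)^2 = 1 - K]. Each iterate is a
    polynomial in [K], whence linearity, symmetry and commutation. *)
Fixpoint sqrt_iter n : H -> H :=
  if n is n'.+1 then fun x => 2^-1 *: (K x + sqrt_iter n' (sqrt_iter n' x))
  else fun=> 0.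
Local Notation Y := sqrt_iter.

Let k0 : 0 <= k. Proof. by case/andP: k01. Qed.

Lemma sqrt_iter_linear n : oplinear (Y n).
Proof.
elim: n => [|n IH] a x y /=; first by rewrite scaler0 addr0.
rewrite lK !IH addrACA -[X in _ *: (X + _)]scalerDr [LHS]scalerDr.
by rewrite [in LHS]scalerA mulrC -scalerA.
Qed.

Lemma sqrt_iter_sym n : opsym (Y n).
Proof.
elim: n => [|n IH] x y /=; first by rewrite (form0l iP) (form0r iP).
by rewrite !(formE iP) sK !IH.
Qed.

Lemma sqrt_iter_bound n x : norm (Y n x) <= k * norm x.
Proof.
elim: n x => [|n IH] x /=; first by rewrite (hnorm0 iP) mulr_ge0 ?hnorm_ge0.
rewrite (hnormZ iP) ger0_norm//.
have h1 := hnormD iP (K x) (Y n (Y n x)).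
have h2 : norm (Y n (Y n x)) <= k * norm x.
  apply: le_trans (IH _) _; apply: ler_wpM2l => //; apply: le_trans (IH _) _.
  by rewrite ler_piMl ?hnorm_ge0//; case/andP: k01 => _ /ltW.
have := bK x; lra.
Qed.

Lemma sqrt_iter_commK n x : Y n (K x) = K (Y n x).
Proof.
elim: n x => [|n IH] x /=; first by rewrite oplinear0.
by rewrite !IH oplinearZ// (oplinearD lK).
Qed.

Lemma sqrt_iter_comm m n x : Y m (Y n x) = Y n (Y m x).
Proof.
elim: n x => [|n IH] x /=; first exact/oplinear0/sqrt_iter_linear.
have lm := sqrt_iter_linear m.
by rewrite (oplinearZ lm) (oplinearD lm) sqrt_iter_commK !IH.
Qed.

(** The iterates commute, so half the difference of two consecutive squares factors as
    [(Y_n+1 - Y_n) (Y_n+1 + Y_n) / 2]. The sum has norm at most [2 k], so each step gains a factor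
    [k]. *)
Lemma sqrt_iter_step n x : norm (Y n.+1 x - Y n x) <= k ^+ n.+1 * norm x.
Proof.
elim: n x => [|n IH] x.
  rewrite /= subr0 addr0 (hnormZ iP) ger0_norm// expr1.
  have := bK x; have := hnorm_ge0 inner (K x); lra.
have l1 := sqrt_iter_linear n.+1; have l0 := sqrt_iter_linear n.
have -> : Y n.+2 x - Y n.+1 x =
    2^-1 *: (Y n.+1 (Y n.+1 x + Y n x) - Y n (Y n.+1 x + Y n x)).
  rewrite (oplinearD l1) (oplinearD l0) (sqrt_iter_comm n n.+1).
  rewrite -[Y n.+2 x]/(2^-1 *: (K x + Y n.+1 (Y n.+1 x))).
  rewrite -[X in _ - X = _]/(2^-1 *: (K x + Y n (Y n x))) -scalerBr.
  by rewrite opprD addrACA subrr add0r opprD addrA addrK.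
rewrite (hnormZ iP) ger0_norm// (exprS _ n.+1).
apply: le_trans (_ : 2^-1 * (k ^+ n.+1 * (k * norm x + k * norm x)) <= _); last first.
  by rewrite le_eqVlt; apply/orP; left; apply/eqP; field.
apply: ler_wpM2l => //; apply: le_trans (IH _) _.
apply: ler_wpM2l; first exact: exprn_ge0.
by apply: le_trans (hnormD iP _ _) _; apply: lerD; exact: sqrt_iter_bound.
Qed.

Lemma sqrt_iter_cauchy x m n :
  norm (Y (n + m)%N x - Y n x) <= k ^+ n * (norm x / (1 - k)).
Proof.
have k1 : 0 < 1 - k by rewrite subr_gt0; case/andP: k01.
(* The exact geometric partial sum is kept, so that the induction on [m] closes. *)
have h : norm (Y (n + m)%N x - Y n x) <= (k ^+ n - k ^+ (n + m)) * (norm x / (1 - k)).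
  elim: m => [|m IH]; first by rewrite addn0 !subrr mul0r (hnorm0 iP).
  rewrite addnS -(subrK (Y (n + m) x) (Y (n + m).+1 x)) -addrA.
  apply: le_trans (hnormD iP _ _) _.
  apply: le_trans (lerD (sqrt_iter_step _ _) IH) _.
  have -> : (k ^+ n - k ^+ (n + m).+1) * (norm x / (1 - k)) =
    (k ^+ n - k ^+ (n + m)) * (norm x / (1 - k)) + k ^+ (n + m) * norm x.
    by rewrite exprS; field; rewrite gt_eqF.
  rewrite addrC lerD2l; apply: ler_wpM2r; first exact: hnorm_ge0.
  rewrite exprS ler_piMl ?exprn_ge0//; by case/andP: k01 => _ /ltW.
apply: le_trans h _; apply: ler_wpM2r.
  by rewrite divr_ge0 ?hnorm_ge0// ltW.
by rewrite lerBlDr lerDl exprn_ge0.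
Qed.

Lemma contraction_sqrt : exists Yl : H -> H,
  [/\ oplinear Yl, opsym Yl, forall x, norm (Yl x) <= k * norm x
    & forall x, 2 *: Yl x = K x + Yl (Yl x)].
Proof.
have Ycvg x : exists l, hcvg inner (Y ^~ x) l.
  exact: (hilbert_complete hH k01 (sqrt_iter_cauchy x)).
pose Yl x := projT1 (cid (Ycvg x)).
have YlP x : hcvg inner (Y ^~ x) (Yl x) by exact: (projT2 (cid (Ycvg x))).
exists Yl; split.
- move=> a x y; apply: (hcvg_unique hH (YlP _)).
  under eq_fun do rewrite sqrt_iter_linear.
  by apply: (hcvgD hH) => //; exact: (hcvgZ hH).
- move=> x y.
  have h1 := hcvg_innerl hH (y := y) (YlP x).
  have h2 := hcvg_innerl hH (y := x) (YlP y).
  rewrite (formC iP x); apply: (cvg_unique _ h1) => //.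
  suff -> : (fun n => inner (Y n x) y) = (fun n => inner (Y n y) x) by [].
  by apply/funext => n; rewrite sqrt_iter_sym (formC iP).
- by move=> x; apply: (hcvg_norm_le hH (YlP x)) => n; exact: sqrt_iter_bound.
- move=> x.
  (* Convergence is only pointwise in [x]. The uniform bound [k] on the iterates controls
     [Y_n (Y_n x - Yl x)], and pointwise convergence at [Yl x] does the rest. *)
  have YY : hcvg inner (fun n => Y n (Y n x)) (Yl (Yl x)).
    apply: (@hcvg_squeeze _ _ _ _ _
      (fun n => k * norm (Y n x - Yl x) + norm (Y n (Yl x) - Yl (Yl x)))).
      move=> n; rewrite -(subrK (Y n (Yl x)) (Y n (Y n x))) -addrA.
      apply: le_trans (hnormD iP _ _) _; rewrite lerD2r.
      by rewrite -(oplinearB (sqrt_iter_linear n)) sqrt_iter_bound.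
    rewrite -[0 : R]addr0 -[in X in nbhs (X + _)](mulr0 k).
    by apply: cvgD; [apply: cvgM; [exact: cvg_cst|exact: YlP]|exact: YlP].
  have h := hcvgD hH (hcvg_cst hH (K x)) YY.
  apply: hcvg_unique h => //.
  have -> : (fun n => K x + Y n (Y n x)) = (fun n => 2 *: Y n.+1 x).
    by apply/funext => n /=; rewrite scalerA mulfV// scale1r.
  apply: (hcvgZ hH).
  have := YlP x; rewrite /hcvg -(@cvg_shiftS _ (fun n => norm (Y n x - Yl x))).
  exact.
Qed.

End fixed_point.

(* With [A = L (1 - K)], the square root of [1 - K] is [1 - Y] for the fixed
   point [2 Y = K + Y^2]; dividing it by [A] gives the inverse square root. *)
Lemma inv_sqrt_exists (A Ai : H -> H) (l L : R) :
  oplinear A -> opsym A -> oplinear Ai ->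
  (forall x, A (Ai x) = x) -> (forall x, Ai (A x) = x) ->
  0 < l <= L ->
  (forall x, l * inner x x <= inner (A x) x <= L * inner x x) ->
  exists S, is_inv_sqrt inner A S.
Proof.
move=> lA sA lAi AK KA /andP[l0 lL] Ab.
have L0 : 0 < L by exact: lt_le_trans lL.
pose K x := x - L^-1 *: A x.
have lK : oplinear K.
  move=> a x y; rewrite /K lA scalerDr opprD scalerBr addrACA; congr (_ - _ + _).
  by rewrite !scalerA mulrC.
have sK : opsym K by move=> x y; rewrite /K !(formE iP) sA.
have Kxx x : 0 <= inner (K x) x <= (1 - l / L) * inner x x.
  have /andP[h1 h2] := Ab x; rewrite /K !(formE iP); apply/andP; split.
    by rewrite subr_ge0 mulrC ler_pdivrMr// mulrC.
  rewrite mulrBl mul1r lerD2l lerN2 mulrAC mulrC; apply: ler_wpM2l => //.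
  by rewrite invr_ge0 ltW.
pose k := 1 - l / L.
have k01 : 0 <= k < 1.
  rewrite /k subr_ge0 ltrBlDr ltrDl divr_gt0// andbT.
  by rewrite ler_pdivrMr// mul1r.
have KP : psd_form (fun x y => inner (K x) y).
  split=> [x y|a x y z|x]; first by rewrite sK (formC iP).
    by rewrite lK !(formE iP).
  by case/andP: (Kxx x).
(* From quadratic form to norm: Cauchy-Schwarz for the form [<K x, y>] gives [|K x|^4 <= <K x, x> <K
   (K x), K x> <= k^2 |x|^2 |K x|^2]. *)
have bK x : norm (K x) <= k * norm x.
  have k0 : 0 <= k by case/andP: k01.
  have [->|Kx0] := eqVneq (norm (K x)) 0; first by rewrite mulr_ge0 ?hnorm_ge0.
  have Kx_gt0 : 0 < norm (K x) by rewrite lt_def Kx0 hnorm_ge0.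
  rewrite -(@ler_pXn2r _ 2)// ?nnegrE ?mulr_ge0 ?hnorm_ge0//.
  rewrite -(@ler_pM2r _ (norm (K x) ^+ 2)) ?exprn_gt0//.
  rewrite -expr2 [X in X ^+ 2](sqr_hnorm iP).
  apply: le_trans (form_cauchy_schwarz KP x (K x)) _.
  rewrite exprMn !(sqr_hnorm iP) expr2.
  have -> : k * k * inner x x * inner (K x) (K x) =
    (k * inner x x) * (k * inner (K x) (K x)) by ring.
  have /andP[? ?] := Kxx x; have /andP[? ?] := Kxx (K x).
  exact: ler_pM.
have [Y [lY sY bY YE]] := contraction_sqrt lK sK k01 bK.
pose Q x := x - Y x.
have lQ : oplinear Q.
  by move=> a x y; rewrite /Q lY scalerBr opprD addrACA.
have sQ : opsym Q by move=> x y; rewrite /Q !(formE iP) sY.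
have QQ x : L *: Q (Q x) = A x.
  have -> : Q (Q x) = L^-1 *: A x.
    have -> : L^-1 *: A x = x - K x by rewrite /K opprB addrCA subrr addr0.
    have -> : K x = 2 *: Y x - Y (Y x) by rewrite YE addrK.
    by rewrite /Q (oplinearB lY) !opprB scaler_nat mulr2n opprD !addrA (addrAC x).
  by rewrite scalerA mulfV ?gt_eqF// scale1r.
have QA x : Q (A x) = A (Q x) by rewrite -!QQ (oplinearZ lQ).
have QAi x : Q (Ai x) = Ai (Q x) by rewrite -[LHS]KA -QA AK.
have sAi : opsym Ai.
  by move=> x y; rewrite -{2}(AK x) sA AK.
have Q_ge0 x : 0 <= inner (Q x) x.
  rewrite /Q !(formE iP) subr_ge0; apply: le_trans (ler_norm _) _.
  apply: le_trans (normr_form_le iP _ _) _.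
  rewrite -(sqr_hnorm iP) expr2; apply: ler_wpM2r; first exact: hnorm_ge0.
  apply: le_trans (bY x) _; rewrite ler_piMl ?hnorm_ge0//.
  by case/andP: k01 => _ /ltW.
have sL : Num.sqrt L * Num.sqrt L = L by rewrite -expr2 sqr_sqrtr// ltW.
pose S x := Num.sqrt L *: Ai (Q x).
have SS x : S (S x) = Ai x.
  rewrite /S (oplinearZ lQ) (oplinearZ lAi) scalerA sL QAi.
  by rewrite -!(oplinearZ lAi) QQ KA.
exists S; split.
- move=> a x y; rewrite /S lQ lAi scalerDr; congr (_ + _).
  by rewrite !scalerA mulrC.
- by move=> x y; rewrite /S !(formE iP) sAi sQ QAi.
(* With [y = Q (Ai x)] one has [<Ai (Q x), x> = L <y, Q y>], because
   [x = A (Ai x) = L Q (Q (Ai x))]. *)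
- move=> x; rewrite /S (formZl iP) mulr_ge0 ?sqrtr_ge0//.
  rewrite -{2}(AK x) -QQ (formZr iP) (mulr_ge0 (ltW L0))//.
  by rewrite -QAi (formC iP).
- by move=> x; rewrite SS KA.
- by move=> x; rewrite SS AK.
Qed.

End operator_sqrt.

(** * The regularized operator, its inverse and the associated quadratic form *)

Section regularized_inverse.
Variables (R : realType) (H : lmodType R) (inner : H -> H -> R) (rho : R).
Hypothesis hH : is_separable_hilbert inner.
Hypothesis rho0 : 0 < rho.
Implicit Type X : nat -> H.

Let iP := inner_psd hH.

(* The inverse of [rho I + V_t], updated by the Sherman-Morrison formula. *)
Fixpoint regVinv X (t : nat) : H -> H :=
  if t is t'.+1 then
    let u := regVinv X t' (X t) in
    fun x => regVinv X t' x - (inner u x / (1 + inner (X t) u)) *: u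
  else fun x => rho^-1 *: x.

Lemma regV0 X x : regV inner rho X 0 x = rho *: x.
Proof. by rewrite /regV big_nil addr0. Qed.

Lemma regVS X t x : regV inner rho X t.+1 x =
  regV inner rho X t x + inner (X t.+1) x *: X t.+1.
Proof. by rewrite /regV big_nat_recr//= addrA. Qed.

Lemma regV_linear X t : oplinear (regV inner rho X t).
Proof.
elim: t => [|t IH] a x y; first by rewrite !regV0 scalerDr !scalerA mulrC.
by rewrite !regVS IH (formDr iP) (formZr iP) scalerDl [in RHS]scalerDr scalerA addrACA.
Qed.

Lemma regV_sym X t : opsym inner (regV inner rho X t).
Proof.
elim: t => [|t IH] x y; first by rewrite !regV0 !(formE iP).
by rewrite !regVS (formDl iP) (formDr iP) (formZl iP) (formZr iP) IH (formC iP x (X _)) mulrC.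
Qed.

Lemma regV_ge X t x : rho * inner x x <= inner (regV inner rho X t x) x.
Proof.
elim: t => [|t IH]; first by rewrite regV0 (formE iP).
by rewrite regVS (formDl iP) (formZl iP); apply: ler_wpDr => //; rewrite -expr2 sqr_ge0.
Qed.

Lemma regV_le X t x : inner (regV inner rho X t x) x <=
  (rho + \sum_(1 <= i < t.+1) inner (X i) (X i)) * inner x x.
Proof.
elim: t => [|t IH]; first by rewrite regV0 big_nil addr0 (formE iP).
rewrite regVS (formDl iP) (formZl iP) big_nat_recr//= addrA mulrDl lerD//.
by rewrite -expr2; exact: (form_cauchy_schwarz iP).
Qed.

Lemma regVinvP X t : [/\ oplinear (regVinv X t), opsym inner (regVinv X t),
   forall x, 0 <= inner x (regVinv X t x),
   forall x, regV inner rho X t (regVinv X t x) = x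
 & forall x, regVinv X t (regV inner rho X t x) = x].
Proof.
suff [lV sV VK KV] : [/\ oplinear (regVinv X t), opsym inner (regVinv X t),
   forall x, regV inner rho X t (regVinv X t x) = x
 & forall x, regVinv X t (regV inner rho X t x) = x].
  (* Positivity of the inverse is the coercivity [regV_ge] at the vector [regVinv X t x]. *)
  split=> // x; rewrite -{1}(VK x); apply: le_trans (regV_ge X t _).
  by rewrite mulr_ge0 ?(form_ge0 iP) ?ltW.
have rhoN0 : rho != 0 by rewrite gt_eqF.
elim: t => [|t [lV sV VK KV]].
  split=> [a x y|x y|x|x] /=.
  - by rewrite scalerDr !scalerA mulrC.
  - by rewrite !(formE iP).
  - by rewrite regV0 scalerA mulfV// scale1r.
  - by rewrite regV0 scalerA mulVf// scale1r.
set z := X t.+1; set u := regVinv X t z.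
(* Coercivity at [u] makes [inner z u] non-negative, so the Sherman-Morrison denominator is at least
   1. *)
have d0 : 1 + inner z u != 0.
  rewrite gt_eqF// ltr_wpDr// /u -{1}(VK z).
  by apply: le_trans (regV_ge X t _); rewrite mulr_ge0 ?(form_ge0 iP) ?ltW.
have uE x : inner u x = inner z (regVinv X t x) by rewrite sV.
split=> [a x y|x y|x|x] /=; rewrite -/z -/u.
- rewrite lV !(formE iP) mulrDl scalerDl scalerBr opprD addrACA -mulrA.
  by rewrite -scalerA.
- by rewrite !(formE iP) sV (formC iP x u); congr (_ - _); ring.
- set c := _ / _; rewrite (oplinearB (regV_linear X t.+1)).
  rewrite (oplinearZ (regV_linear X t.+1)) !regVS !VK -/z -uE scalerDr opprD.
  rewrite addrACA scalerA -addrA -[RHS]addr0; congr (_ + _).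
  rewrite -scaleNr -scalerBl -scalerDl -[RHS](scale0r z); congr (_ *: _).
  by rewrite /c; field.
- rewrite regVS (oplinearD lV) (oplinearZ lV) KV -/z -/u.
  rewrite (_ : _ / _ = inner z x) ?addrK//.
  by rewrite (formDr iP) (formZr iP) (uE (regV _ _ _ _ _)) KV (formC iP u z); field.
Qed.

Definition qform X t (x y : H) : R := inner x (regVinv X t y).

Lemma qform_psd X t : psd_form (qform X t).
Proof.
have [lV sV V0 _ _] := regVinvP X t; rewrite /qform; split=> [x y|a x y z|x//].
  by rewrite -sV (formC iP).
by rewrite !(formE iP).
Qed.

Lemma qform0 X x y : qform X 0 x y = rho^-1 * inner x y.
Proof. by rewrite /qform /= (formE iP). Qed.

Lemma qformS X t x y : qform X t.+1 x y = qform X t x y -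
  qform X t x (X t.+1) * qform X t (X t.+1) y / (1 + qform X t (X t.+1) (X t.+1)).
Proof.
have [_ sV _ _ _] := regVinvP X t.
by rewrite /qform /= !(formE iP) sV; congr (_ - _); ring.
Qed.

Lemma qformS_le X t x : qform X t.+1 x x <= qform X t x x.
Proof.
have qP := qform_psd X t.
rewrite qformS lerBlDr lerDl (formC qP x) divr_ge0//.
  by rewrite -expr2 sqr_ge0.
by rewrite addr_ge0// (form_ge0 qP).
Qed.

(** With [g] the value before the update, the value after it is [g / (1 + g)]. This is the bound
    [|G_t| <= 1], which keeps the increments within [B]. *)
Lemma qform_last_le1 X t : qform X t.+1 (X t.+1) (X t.+1) <= 1.
Proof.
have g0 := form_ge0 (qform_psd X t) (X t.+1).
rewrite qformS; set g := qform _ _ _ _ in g0 *.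
have -> : g - g * g / (1 + g) = g / (1 + g) by field; rewrite gt_eqF// ltr_wpDr.
by rewrite ler_pdivrMr ?ltr_wpDr// mul1r lerDr.
Qed.

(** [|S x|^2 = <x, S (S x)>], and [S S] is the inverse whichever root [epsilon] picks. Existence of
    a root is what gives the chosen one its specification. *)
Lemma hnorm_inv_sqrt X t x :
  hnorm inner (inv_sqrt inner (regV inner rho X t) x) = Num.sqrt (qform X t x x).
Proof.
have [lV sV V0 VK KV] := regVinvP X t.
have : exists S, is_inv_sqrt inner (regV inner rho X t) S.
  apply: (inv_sqrt_exists hH (regV_linear X t) (regV_sym X t) lV VK KV
    (l := rho) (L := rho + \sum_(1 <= i < t.+1) inner (X i) (X i))).
  - by rewrite rho0 lerDl sumr_ge0// => i _; exact: (form_ge0 iP).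
  - by move=> y; rewrite regV_ge regV_le.
move=> /(epsilon_spec (inhabits (fun x : H => x)) (is_inv_sqrt inner (regV inner rho X t))).
rewrite -/(inv_sqrt inner (regV inner rho X t)).
move=> [_ sS _ _ SS]; rewrite /hnorm sS /qform.
by rewrite -[in LHS](KV (inv_sqrt _ _ (inv_sqrt _ _ _))) SS.
Qed.

Lemma s_tE X e t :
  s_t inner rho X e t = Num.sqrt (qform X t (Mt X e t) (Mt X e t)).
Proof. exact: hnorm_inv_sqrt. Qed.

Lemma sqr_hnorm_G_t X t :
  hnorm inner (G_t inner rho X t) ^+ 2 = qform X t (X t) (X t).
Proof. by rewrite /G_t hnorm_inv_sqrt sqr_sqrtr// (form_ge0 (qform_psd X t)). Qed.

End regularized_inverse.

(** * Hyperbolic functions and the deterministic one-step inequality *)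

Section hyperbolic.
Variable R : realType.
Implicit Types x y q r : R.

Definition coshR x := (expR x + expR (- x)) / 2.
Definition sinhR x := (expR x - expR (- x)) / 2.

Lemma coshR_ge0 x : 0 <= coshR x.
Proof. by rewrite /coshR divr_ge0// addr_ge0// expR_ge0. Qed.

Lemma coshR0 : coshR 0 = 1.
Proof. by rewrite /coshR oppr0 expR0; field. Qed.

Lemma sinhR_ge0 x : 0 <= x -> 0 <= sinhR x.
Proof. by move=> x0; rewrite /sinhR divr_ge0// subr_ge0 ler_expR; lra. Qed.

Lemma sinhR_le_coshR x : sinhR x <= coshR x.
Proof. by rewrite /sinhR /coshR; have := expR_ge0 (- x); lra. Qed.

Lemma expR_le_2coshR x : expR x <= 2 * coshR x.
Proof. by rewrite /coshR; have := expR_ge0 (- x); lra. Qed.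

Lemma coshRD x y : coshR (x + y) = coshR x * coshR y + sinhR x * sinhR y.
Proof. by rewrite /coshR /sinhR opprD !expRD; field. Qed.

Lemma coshRB x y : coshR (x - y) = coshR x * coshR y - sinhR x * sinhR y.
Proof. by rewrite /coshR /sinhR opprB addrC !expRD; field. Qed.

Lemma coshR_homo x y : 0 <= x <= y -> coshR x <= coshR y.
Proof.
move=> /andP[x0 xy].
have -> : coshR y = coshR x * coshR (y - x) + sinhR x * sinhR (y - x).
  by rewrite -coshRD addrC subrK.
have h : 1 <= coshR (y - x).
  rewrite /coshR; have := expR_ge1Dx (y - x); have := expR_ge1Dx (- (y - x)); lra.
rewrite -[leLHS]addr0 lerD//; first by rewrite ler_peMr// coshR_ge0.
by rewrite mulr_ge0// sinhR_ge0// subr_ge0.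
Qed.

Lemma expR_series_cvg x : series (exp_coeff x) n @[n --> \oo] --> expR x.
Proof. exact: is_cvg_series_exp_coeff. Qed.

(** Coefficients in [q = x^2], so that convexity in [q] can be read off termwise. The odd entries
    stay as zeros to align the partial sums with those of [exp_coeff]. *)
Definition cosh_coeff q n : R := if odd n then 0 else q ^+ n./2 / n`!%:R.

Lemma coshR_series_cvg x : series (cosh_coeff (x ^+ 2)) n @[n --> \oo] --> coshR x.
Proof.
have h : (series (exp_coeff x) n + series (exp_coeff (- x)) n) / 2 @[n --> \oo]
    --> coshR x.
  by apply: cvgMl; apply: cvgD; exact: expR_series_cvg.
suff -> : series (cosh_coeff (x ^+ 2)) =
  (fun n => (series (exp_coeff x) n + series (exp_coeff (- x)) n) / 2) by [].
apply/funext => n; rewrite /series /= -big_split /= mulr_suml.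
apply: eq_bigr => i _; rewrite /cosh_coeff /exp_coeff /= exprNn -exprM.
rewrite -signr_odd; case: ifPn => oi.
  by rewrite expr1; field; rewrite pnatr_eq0 -lt0n fact_gt0.
rewrite expr0 mul1r mul2n even_halfK//.
by field; rewrite pnatr_eq0 -lt0n fact_gt0.
Qed.

Lemma convex_exprn (a x y : R) n : 0 <= a <= 1 -> 0 <= x -> 0 <= y ->
  (a * x + (1 - a) * y) ^+ n <= a * x ^+ n + (1 - a) * y ^+ n.
Proof.
move=> /andP[a0 a1] x0 y0; have a1' : 0 <= 1 - a by rewrite subr_ge0.
elim: n => [|n IH]; first by rewrite !expr0; lra.
rewrite exprS.
apply: le_trans (_ : (a * x + (1 - a) * y) * (a * x ^+ n + (1 - a) * y ^+ n) <= _).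
  by apply: ler_wpM2l => //; rewrite addr_ge0// mulr_ge0.
rewrite -subr_ge0.
(* Chebyshev's identity: [x - y] and [x^n - y^n] have the same sign. *)
have -> : a * x ^+ n.+1 + (1 - a) * y ^+ n.+1 -
  (a * x + (1 - a) * y) * (a * x ^+ n + (1 - a) * y ^+ n) =
  a * (1 - a) * ((x - y) * (x ^+ n - y ^+ n)) by rewrite !exprS; ring.
apply: mulr_ge0; first exact: mulr_ge0.
have [xy|/ltW yx] := leP x y.
  by rewrite mulr_le0// subr_le0// lerXn2r.
by rewrite mulr_ge0// subr_ge0// lerXn2r.
Qed.

(* All power series coefficients of [cosh (sqrt q)] in [q] are nonnegative. *)
Lemma coshR_sqrt_convex (a x y : R) : 0 <= a <= 1 ->
  coshR (Num.sqrt (a * x ^+ 2 + (1 - a) * y ^+ 2)) <=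
  a * coshR x + (1 - a) * coshR y.
Proof.
move=> a01; have /andP[a0 a1] := a01.
have a1' : 0 <= 1 - a by rewrite subr_ge0.
set z := Num.sqrt _.
have zE : z ^+ 2 = a * x ^+ 2 + (1 - a) * y ^+ 2.
  by rewrite sqr_sqrtr// addr_ge0// mulr_ge0// sqr_ge0.
have h1 := @coshR_series_cvg z.
have h2 : a * series (cosh_coeff (x ^+ 2)) n +
  (1 - a) * series (cosh_coeff (y ^+ 2)) n @[n --> \oo] -->
  a * coshR x + (1 - a) * coshR y.
  by apply: cvgD; apply: cvgMr; exact: coshR_series_cvg.
apply: (ler_cvg_to h1 h2); near=> n.
rewrite /series /= !mulr_sumr -big_split/=; apply: ler_sum => i _.
rewrite /cosh_coeff; case: ifP => _; first by rewrite !mulr0 addr0.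
rewrite !mulrA -mulrDl; apply: ler_wpM2r; first by rewrite invr_ge0.
by rewrite zE; apply: convex_exprn => //; rewrite sqr_ge0.
Unshelve. all: by end_near. Qed.

(** All terms of the series are non-negative, and the linear one is [x]. *)
Lemma sinhR_ge x : 0 <= x -> x <= sinhR x.
Proof.
move=> x0.
have h : (series (exp_coeff x) n - series (exp_coeff (- x)) n) / 2 @[n --> \oo]
    --> sinhR x.
  by apply: cvgMl; apply: cvgB; exact: expR_series_cvg.
apply: (cvgr_to_ge h); near=> n.
rewrite /series /= -sumrB.
have n2 : (2 <= n)%N by near: n; exact: nbhs_infty_ge.
rewrite -(subnK n2) addn2 !big_nat_recl//=.
have : 0 <= \sum_(0 <= i < n - 2) (exp_coeff x i.+2 - exp_coeff (- x) i.+2).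
  apply: sumr_ge0 => i _; rewrite /exp_coeff /= -mulrBl divr_ge0//.
  rewrite subr_ge0 exprNn -signr_odd; case: odd; rewrite ?expr1 ?expr0 ?mul1r//.
  by rewrite mulN1r; have := exprn_ge0 i.+2 x0; lra.
rewrite /exp_coeff /= !expr0 !expr1 !fact0 !divr1; lra.
Unshelve. all: by end_near. Qed.

(** Termwise, [a^i <= a^2] for [i >= 2]. As in Bennett's inequality, this trades the actual size of
    an increment for the bound [B] and leaves its square as a variance factor. *)
Lemma expR_sub_scale (a x : R) : 0 <= a <= 1 -> 0 <= x ->
  expR (a * x) - 1 - a * x <= a ^+ 2 * (expR x - 1 - x).
Proof.
move=> /andP[a0 a1] x0.
have h1 : series (exp_coeff (a * x)) n - 1 - a * x @[n --> \oo] -->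
    expR (a * x) - 1 - a * x.
  apply: cvgB; last exact: cvg_cst; apply: cvgB; last exact: cvg_cst.
  exact: expR_series_cvg.
have h2 : a ^+ 2 * (series (exp_coeff x) n - 1 - x) @[n --> \oo] -->
    a ^+ 2 * (expR x - 1 - x).
  apply: cvgMr; apply: cvgB; last exact: cvg_cst; apply: cvgB; last exact: cvg_cst.
  exact: expR_series_cvg.
apply: (ler_cvg_to h1 h2); near=> n.
have n2 : (2 <= n)%N by near: n; exact: nbhs_infty_ge.
rewrite /series /= -(subnK n2) addn2 !big_nat_recl//=.
have : \sum_(0 <= i < n - 2) exp_coeff (a * x) i.+2 <=
   a ^+ 2 * \sum_(0 <= i < n - 2) exp_coeff x i.+2.
  rewrite mulr_sumr; apply: ler_sum => i _; rewrite /exp_coeff /= mulrA.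
  apply: ler_wpM2r; first by rewrite invr_ge0.
  rewrite exprMn; apply: ler_wpM2r; first exact: exprn_ge0.
  by rewrite -addn2 exprD ler_piMl ?sqr_ge0// exprn_ile1.
rewrite /exp_coeff /= !expr0 !expr1 !fact0 !divr1; lra.
Unshelve. all: by end_near. Qed.

(* The left side is convex and the right side affine in [b], so the extreme
   cases [b = 1] and [b = -1] suffice. *)
Lemma coshR_pinelis (p r b : R) : 0 <= p -> 0 <= r -> -1 <= b <= 1 ->
  coshR (Num.sqrt (p ^+ 2 + 2 * b * p * r + r ^+ 2)) <=
  coshR p + b * r * sinhR p + coshR p * (expR r - 1 - r).
Proof.
move=> p0 r0 /andP[b1 b2].
have a01 : 0 <= (1 + b) / 2 <= 1 by lra.
have -> : p ^+ 2 + 2 * b * p * r + r ^+ 2 =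
  (1 + b) / 2 * (p + r) ^+ 2 + (1 - (1 + b) / 2) * (p - r) ^+ 2 by field.
apply: le_trans (coshR_sqrt_convex _ _ a01) _.
rewrite coshRD coshRB -subr_ge0.
(* The gap factors because [exp r = cosh r + sinh r]; both factors are non-negative. *)
have -> : coshR p + b * r * sinhR p + coshR p * (expR r - 1 - r) -
  ((1 + b) / 2 * (coshR p * coshR r + sinhR p * sinhR r) +
   (1 - (1 + b) / 2) * (coshR p * coshR r - sinhR p * sinhR r)) =
  (coshR p - b * sinhR p) * (sinhR r - r).
  have -> : expR r = coshR r + sinhR r by rewrite /coshR /sinhR; field.
  by field.
apply: mulr_ge0; last by rewrite subr_ge0 sinhR_ge.
rewrite subr_ge0; apply: le_trans (sinhR_le_coshR p).
by rewrite ler_piMl ?sinhR_ge0.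
Qed.

Definition bpsi (B lam : R) := (expR (lam * B) - 1 - lam * B) / B ^+ 2.

Lemma bpsi_ge0 B lam : 0 <= bpsi B lam.
Proof.
rewrite /bpsi divr_ge0 ?sqr_ge0//.
by have := expR_ge1Dx (lam * B); lra.
Qed.

(** The derivative at [e = 0] of [cosh (lam sqrt (p + 2 e m + e^2 g))]. At [p = 0] the division
    yields 0, in accordance with [m^2 <= p g], which forces [m = 0]. *)
Definition cosh_slope (lam p m : R) :=
  lam * m * sinhR (lam * Num.sqrt p) / Num.sqrt p.

Section step.
Variables (lam B p g m : R).
Hypotheses (lam0 : 0 <= lam) (B0 : 0 < B) (p0 : 0 <= p) (g01 : 0 <= g <= 1).
Hypothesis mpg : m ^+ 2 <= p * g.

Let g0 : 0 <= g. Proof. by case/andP: g01. Qed.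

Let m_le : `|m| <= Num.sqrt p * Num.sqrt g.
Proof. by rewrite -sqrtrM// -sqrtr_sqr ler_wsqrtr. Qed.

(** Since [|m| <= sqrt p], the denominator cancels. A bounded slope is needed for the term linear in
    [eps] to have a finite integral. *)
Lemma cosh_slope_le : `|cosh_slope lam p m| <= lam * coshR (lam * Num.sqrt p).
Proof.
have [p00|p00] := eqVneq (Num.sqrt p) 0.
  by rewrite /cosh_slope p00 invr0 mulr0 normr0 mulr_ge0 ?coshR_ge0.
have sp : 0 < Num.sqrt p by rewrite lt_def p00 sqrtr_ge0.
have s0 : 0 <= sinhR (lam * Num.sqrt p) by rewrite sinhR_ge0// mulr_ge0// ltW.
rewrite /cosh_slope normrM normfV normrM (ger0_norm s0) (gtr0_norm sp).
rewrite normrM (ger0_norm lam0).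
rewrite ler_pdivrMr// -mulrA -(mulrA lam (coshR _)); apply: ler_wpM2l => //.
rewrite (mulrC `|m|); apply: ler_pM => //; first exact: sinhR_le_coshR.
apply: le_trans m_le _; rewrite ler_piMr ?sqrtr_ge0//.
by rewrite -sqrtr1 ler_wsqrtr//; case/andP: g01.
Qed.

(** Here [p], [m], [g] stand for [|y|^2], [<y, G>], [|G|^2], so the argument on the left is
    [lam |y + e G|]. *)
Lemma coshR_step (e : R) : `|e| <= B ->
  coshR (lam * Num.sqrt (p + 2 * e * m + e ^+ 2 * g)) <=
  coshR (lam * Num.sqrt p) + e * cosh_slope lam p m +
  coshR (lam * Num.sqrt p) * (e ^+ 2 * g * bpsi B lam).
Proof.
move=> eB; set P := lam * Num.sqrt p; set r := lam * (`|e| * Num.sqrt g).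
have P0 : 0 <= P by rewrite mulr_ge0 ?sqrtr_ge0.
have eg0 : 0 <= `|e| * Num.sqrt g by rewrite mulr_ge0 ?sqrtr_ge0.
have r0 : 0 <= r by rewrite mulr_ge0.
have em_le : `|e * m| <= Num.sqrt p * (`|e| * Num.sqrt g).
  by rewrite normrM mulrCA; apply: ler_wpM2l.
(* The cosine of the angle between [y] and [e G]. If one of them vanishes then [b = 0], and [bE]
   still holds because [e m = 0]. *)
pose b := e * m / (Num.sqrt p * (`|e| * Num.sqrt g)).
have bE : b * (Num.sqrt p * (`|e| * Num.sqrt g)) = e * m.
  have [z|z] := eqVneq (Num.sqrt p * (`|e| * Num.sqrt g)) 0.
    rewrite z mulr0; move: em_le; rewrite z normr_le0 => /eqP ->//.
  by rewrite /b divfK.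
have b1 : -1 <= b <= 1.
  rewrite -ler_norml /b normrM normfV (ger0_norm (mulr_ge0 (sqrtr_ge0 _) eg0)).
  have [->|z] := eqVneq (Num.sqrt p * (`|e| * Num.sqrt g)) 0.
    by rewrite invr0 mulr0.
  by rewrite ler_pdivrMr ?mul1r// lt_def z mulr_ge0 ?sqrtr_ge0.
have sqE : (`|e| * Num.sqrt g) ^+ 2 = e ^+ 2 * g.
  by rewrite exprMn real_normK ?num_real// sqr_sqrtr.
have -> : lam * Num.sqrt (p + 2 * e * m + e ^+ 2 * g) =
   Num.sqrt (P ^+ 2 + 2 * b * P * r + r ^+ 2).
  rewrite -[X in X * _ = _](ger0_norm lam0) -sqrtr_sqr -sqrtrM ?sqr_ge0//.
  congr Num.sqrt.
  have -> : P ^+ 2 = lam ^+ 2 * p by rewrite exprMn sqr_sqrtr.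
  have -> : r ^+ 2 = lam ^+ 2 * (e ^+ 2 * g) by rewrite exprMn sqE.
  have -> : 2 * b * P * r =
    lam ^+ 2 * (2 * (b * (Num.sqrt p * (`|e| * Num.sqrt g)))) by rewrite /P /r; ring.
  by rewrite bE; ring.
apply: le_trans (coshR_pinelis P0 r0 b1) _.
have slopeE : b * r * sinhR P = e * cosh_slope lam p m.
  rewrite /cosh_slope -/P.
  have [sp|sp] := eqVneq (Num.sqrt p) 0.
    by rewrite /P sp mulr0 /sinhR oppr0 subrr mul0r !(mulr0, mul0r).
  have -> : e * (lam * m * sinhR P / Num.sqrt p) =
    (e * m) * (lam * sinhR P / Num.sqrt p) by ring.
  by rewrite -bE /r; field.
rewrite slopeE lerD2l; apply: ler_wpM2l; first exact: coshR_ge0.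
have B0' : B != 0 by rewrite gt_eqF.
(* The ratio of the increment [|e G|] to its bound [B], at most 1 thanks to [g <= 1]. *)
have a01 : 0 <= (`|e| * Num.sqrt g) / B <= 1.
  rewrite (divr_ge0 eg0 (ltW B0))/= ler_pdivrMr// mul1r.
  apply: le_trans eB; rewrite ler_piMr//.
  by rewrite -sqrtr1 ler_wsqrtr//; case/andP: g01.
have := expR_sub_scale a01 (mulr_ge0 lam0 (ltW B0)).
have -> : `|e| * Num.sqrt g / B * (lam * B) = r by rewrite /r; field.
move=> /le_trans; apply; rewrite /bpsi expr_div_n sqE.
by rewrite le_eqVlt; apply/orP; left; apply/eqP; field.
Qed.

End step.

End hyperbolic.

(** * Measurability and integral comparison relative to a sub-sigma-algebra *)

Section sub_sigma_algebra.
Context {d : measure_display} {T : measurableType d} {R : realType}.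
Implicit Types (G : set_system T).

Lemma g_sigma_algebra_measurableE G (A : set T) : sigma_algebra setT G ->
  measurable (A : set (g_sigma_algebraType G)) = G A.
Proof. by move=> sG; rewrite -[in RHS](sigma_algebra_id sG). Qed.

(** Gives access to the closure properties of [measurable_fun] for predictable quantities. *)
Lemma measurable_wrtP G (f : T -> R) : sigma_algebra setT G ->
  measurable_wrt G f <-> measurable_fun setT (f : g_sigma_algebraType G -> R).
Proof.
move=> sG; split=> [mf _ Y mY|mf Y mY].
  by rewrite setTI g_sigma_algebra_measurableE//; exact: mf.
by rewrite -g_sigma_algebra_measurableE// -[X in measurable X]setTI; exact: mf.
Qed.

Lemma measurable_fun_sub (d' : measure_display) (U : measurableType d') G
    (f : T -> U) : sigma_algebra setT G -> G `<=` measurable ->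
  measurable_fun setT (f : g_sigma_algebraType G -> U) -> measurable_fun setT f.
Proof.
move=> sG Gm mf _ Y mY; apply: Gm; rewrite -g_sigma_algebra_measurableE//.
exact: mf.
Qed.

Lemma measurable_fun_filtration (F : nat -> set_system T) s t (f : T -> R) :
  filtration F -> (s <= t)%N -> measurable_wrt (F s) f -> measurable_wrt (F t) f.
Proof. by move=> [_ _ FS] st mf Y mY; apply: (FS _ _ st); exact: mf. Qed.

Variable P : probability T R.

(* Layer cake: [Z = \int 1_{0 <= u < Z} du], and each [{u < Z}] lies in [G]. *)
Lemma le_integral_sub G (f g Z : T -> R) :
  sigma_algebra setT G -> G `<=` measurable ->
  measurable_fun setT f -> measurable_fun setT g -> measurable_wrt G Z ->
  (forall w, 0 <= f w) -> (forall w, 0 <= g w) -> (forall w, 0 <= Z w) ->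
  (forall A, G A -> (\int[P]_(w in A) (f w)%:E <= \int[P]_(w in A) (g w)%:E)%E) ->
  (\int[P]_w (f w * Z w)%:E <= \int[P]_w (g w * Z w)%:E)%E.
Proof.
move=> sG Gm mf mg mZ f0 g0 Z0 fg.
have mZT : measurable_fun setT Z by apply: (measurable_fun_sub sG Gm); exact/measurable_wrtP.
pose k (f : T -> R) (z : T * R) : \bar R :=
  if (0 <= z.2) && (z.2 < Z z.1) then (f z.1)%:E else 0%E.
have mk (h : T -> R) : measurable_fun setT h -> measurable_fun setT (k h).
  move=> mh; apply: measurable_fun_ifT => //.
    apply: measurable_and; first exact: measurable_fun_ler.
    by apply: measurable_fun_ltr => //; exact: measurableT_comp.
  by apply/measurable_EFinP; exact: measurableT_comp.
have k0 (h : T -> R) : (forall w, 0 <= h w) -> forall z, (0 <= k h z)%E.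
  by move=> h0 z; rewrite /k; case: ifP => // _; rewrite lee_fin.
have cake (h : T -> R) : measurable_fun setT h -> (forall w, 0 <= h w) ->
    (\int[P]_w (h w * Z w)%:E =
     \int[lebesgue_measure]_u \int[P]_w k h (w, u))%E.
  move=> mh h0; rewrite -(fubini_tonelli (m1 := P) (m2 := @lebesgue_measure R) _
    (mk _ mh) (k0 _ h0)).
  apply: eq_integral => w _.
  transitivity (\int[lebesgue_measure]_(u in `[0%R, Z w[) (h w)%:E)%E.
    rewrite integral_cst//= lebesgue_measure_itv/= lte_fin.
    case: ltP => [Zw|Zw]; first by rewrite sube0.
    by rewrite mule0; congr EFin; apply/eqP; rewrite mulf_eq0 (eq_le (Z w)) Zw Z0 orbT.
  rewrite integral_mkcond; apply: eq_integral => u _.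
  by rewrite /k patchE mem_setE in_itv.
rewrite !cake//; apply: ge0_le_integral => //.
- by move=> u _; apply: integral_ge0 => w _; exact: k0.
- exact: (measurable_fun_fubini_tonelli_G (m1 := P) _ (mk _ mf) (k0 _ f0)).
- exact: (measurable_fun_fubini_tonelli_G (m1 := P) _ (mk _ mg) (k0 _ g0)).
move=> u _; pose A := [set w | (0 <= u :> R) && (u < Z w)].
have kE (h : T -> R) : (\int[P]_w k h (w, u) = \int[P]_(w in A) (h w)%:E)%E.
  rewrite [RHS]integral_mkcond; apply: eq_integral => w _.
  rewrite /k patchE/=; congr (if _ then _ else _).
  by apply/idP/idP; rewrite inE.
rewrite !kE; apply: fg; rewrite /A.
have [u0|u0] := leP 0 (u : R); last by rewrite [X in G X]set_false; case: sG.
rewrite [X in G X](_ : _ = Z @^-1` `]u, +oo[); first exact: mZ.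
by apply/seteqP; split=> w /=; rewrite in_itv/= andbT.
Qed.

End sub_sigma_algebra.

(** * Ville's maximal inequality *)

Section ville.
Context {d : measure_display} {T : measurableType d} {R : realType}.
Variables (P : probability T R) (F : nat -> set_system T) (Y : nat -> T -> \bar R).
Hypothesis FP : filtration F.
Hypothesis Y0 : forall t w, (0 <= Y t w)%E.
Hypothesis mY : forall t, measurable_fun setT (Y t : g_sigma_algebraType (F t) -> \bar R).
Hypothesis supY : forall t A, F t A ->
  (\int[P]_(w in A) Y t.+1 w <= \int[P]_(w in A) Y t w)%E.

Let sF t : sigma_algebra setT (F t). Proof. by case: FP. Qed.
Let Fm t : F t `<=` measurable. Proof. by case: FP. Qed.
Let mYT t : measurable_fun setT (Y t). Proof. exact: (measurable_fun_sub (sF t) (@Fm t)). Qed.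

(** The event that the first passage to level [k] does not occur before time [n]; it replaces a
    stopping time. *)
Fixpoint below (k : \bar R) n : set T :=
  if n is n'.+1 then below k n' `&` [set w | (Y n' w < k)%E] else setT.

(** Membership one index ahead is what [supY] asks for: [below k n.+1] involves [Y] only up to time
    [n]. *)
Lemma belowP k n : F n (below k n) /\ F n (below k n.+1).
Proof.
have h m : F m (below k m) -> F m (below k m.+1).
  rewrite -(g_sigma_algebra_measurableE (below k m) (sF m)).
  rewrite -(g_sigma_algebra_measurableE (below k m.+1) (sF m)) => mB.
  apply: measurableI => //; rewrite -[X in measurable X]setTI.
  exact: emeasurable_fun_infty_o.
elim: n => [|n [_ IH]].
  have F0 : F 0 (below k 0).
    by rewrite -(g_sigma_algebra_measurableE _ (sF 0)); exact: measurableT.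
  by split=> //; exact: h.
have FS : F n `<=` F n.+1 by case: FP => _ _; exact.
by split; [|apply: h]; exact: FS.
Qed.

(** Optional stopping as an invariant: on the paths that reach [k] exactly at time [n], [Y n] pays
    for their probability times [k]; on those still below, [supY] moves on to [Y n.+1]. *)
Lemma below_ville (k : R) n : 0 <= k ->
  (k%:E * P (~` below k%:E n) + \int[P]_(w in below k%:E n) Y n w <= \int[P]_w Y 0 w)%E.
Proof.
move=> k0; elim: n => [|n IH]; first by rewrite /= setCT measure0 mule0 add0e.
apply: le_trans IH.
have [/Fm mB /[dup] FB1 /Fm mB1] := belowP k%:E n.
set B := below _ n in mB *; set B1 := below _ n.+1 in FB1 mB1 *.
have B1B : B1 `<=` B by move=> w [].
have -> : (\int[P]_(w in B) Y n w = \int[P]_(w in B1) Y n w + \int[P]_(w in B `\` B1) Y n w)%E.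
  rewrite -ge0_integral_setU//.
  - by rewrite setDUK.
  - exact: measurableD.
  - exact: measurable_funTS.
  - by apply/disj_setPS => w [B1w []].
have -> : P (~` B1) = (P (~` B) + P (B `\` B1))%E.
  rewrite -measureU//.
  - congr (P _); apply/seteqP; split=> w; rewrite /setC /setD /=.
      by move=> nB1; case: (pselect (B w)) => Bw; [right|left].
    by case=> [nB /B1B//|[]].
  - exact: measurableC.
  - exact: measurableD.
  - by apply/seteqP; split=> w // [] /[swap] [] [].
rewrite ge0_muleDr// -addeA leeD2l//.
rewrite addeC leeD//; first exact: supY.
rewrite -integral_cst//; last exact: measurableD.
apply: ge0_le_integral => //; first exact: measurableD.
  exact: measurable_funTS.
by move=> w [Bw nB1]; rewrite leNgt; apply/negP => Yk; apply: nB1; split.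
Qed.

Lemma ville (k : R) : 0 <= k ->
  (k%:E * P (\bigcup_t [set w | (k%:E <= Y t w)%E]) <= \int[P]_w Y 0 w)%E.
Proof.
move=> k0.
have mB n : measurable (~` below k%:E n) by apply: measurableC; case: (belowP k%:E n) => /Fm.
have -> : \bigcup_t [set w | (k%:E <= Y t w)%E] = \bigcup_n ~` below k%:E n.
  apply/seteqP; split=> w [n _ /=].
    by move=> kY; exists n.+1 => //= -[_]; rewrite ltNge kY.
  elim: n => [|n IH] /=; first by move=> /(_ I).
  have [kY _|Yk nB] := leP k%:E (Y n w); first by exists n.
  by apply: IH => Bw; apply: nB.
have ndB : {homo (fun n => ~` below k%:E n) : n m / (n <= m)%N >-> (n <= m)%O}.
  apply/nondecreasing_seqP => n; apply/subsetPset; apply: subsetC => w []//.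
have cvgP := nondecreasing_cvg_mu (mu := P) mB (bigcup_measurable (fun n _ => mB n)) ndB.
have h : (k%:E * P (~` below k%:E n) @[n --> \oo] --> k%:E * P (\bigcup_n ~` below k%:E n))%E.
  by apply: cvgeZl => //; exact: cvgP.
rewrite -(cvg_lim _ h)//; apply: lime_le; first by apply/cvg_ex; eexists; exact: h.
near=> n; apply: le_trans (below_ville n k0).
by rewrite leeDl// integral_ge0.
Unshelve. all: by end_near. Qed.

End ville.

(** * Integrating out one noise variable given the past *)

Section conditional_step.
Context {d : measure_display} {T : measurableType d} {R : realType}.
Variables (P : probability T R) (G : set_system T) (eps sigma : T -> R) (B : R).
Hypotheses (sG : sigma_algebra setT G) (Gm : G `<=` measurable) (B0 : 0 < B).
Hypotheses (e0 : condexp_zero P G eps) (eB : forall w, `|eps w| <= B).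
Hypotheses (es : condvar_le P G eps sigma) (ms : measurable_wrt G sigma).

Let meps : measurable_fun setT eps.
Proof. by case: e0 => _ /measurable_int/measurable_EFinP. Qed.

Let mwT (f : T -> R) : measurable_wrt G f -> measurable_fun setT f.
Proof. by move=> mf; apply: (measurable_fun_sub sG Gm); exact/measurable_wrtP. Qed.

(** Applied with [a = B] and [k = 1] or [-1], where the integrand is non-negative and
    [le_integral_sub] applies. *)
Lemma condexp_zero_affine (a k : R) A : G A ->
  (\int[P]_(w in A) (a + k * eps w)%:E = \int[P]_(w in A) a%:E)%E.
Proof.
move=> GA; case: e0 => _ ieps _ /(_ _ GA).
rewrite integral0 => /esym eps0; have mA := Gm GA.
have ie : P.-integrable A (EFin \o eps) by apply: integrableS ieps.
have ia : P.-integrable A (fun=> a%:E).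
  exact: (finite_measure_integrable_cst P a mA).
rewrite -[RHS]adde0 -[X in (_ + X)%E](mule0 k%:E) -eps0 -(integralZl mA ie).
rewrite -(integralD mA ia); last exact: integrableZl.
by apply: eq_integral => w _; rewrite EFinD EFinM.
Qed.

(** The conditional mean [Z1] vanishes almost everywhere, so the variance bound becomes a bound on
    the conditional second moment [Z2]. *)
Lemma condvar_le_integral A : G A ->
  (\int[P]_(w in A) (eps w ^+ 2)%:E <= \int[P]_(w in A) (sigma w ^+ 2)%:E)%E.
Proof.
move=> GA; have mA := Gm GA.
case: es => Z1 [Z2 [[mZ1 _ iZ1 Z1E] [mZ2 _ iZ2 <-//] Z12]].
have Z10 A' : G A' -> (\int[P]_(w in A') (Z1 w)%:E = 0)%E.
  by move=> GA'; rewrite Z1E//; case: e0 => _ _ _ /(_ _ GA') <-; rewrite integral0.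
(* [Z1] integrates to 0 over its own sign sets, which lie in [G]; hence so does [|Z1|] over the
   whole space. *)
have : ae_eq P setT (EFin \o Z1) (cst 0%E).
  apply/(ae_eq_integral_abs P measurableT); first exact/measurable_EFinP/mwT.
  pose A1 := Z1 @^-1` `[0, +oo[; pose A2 := Z1 @^-1` `]-oo, 0[.
  have GA1 : G A1 by exact: mZ1.
  have GA2 : G A2 by exact: mZ1.
  have A12 : A1 `|` A2 = setT.
    apply/seteqP; split=> // w _; rewrite /A1 /A2 /setU/= !in_itv/= andbT.
    by case: leP; [left|right].
  rewrite -A12 ge0_integral_setU//; last 4 first.
  - exact: Gm.
  - exact: Gm.
  - by apply: measurable_funTS; apply: measurableT_comp => //; exact/measurable_EFinP/mwT.
  - by apply/disj_setPS => w; rewrite /A1 /A2 /setI/= !in_itv/= andbT => -[]; case: leP.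
  rewrite (eq_integral (fun w => (Z1 w)%:E)); last first.
    by move=> w; rewrite inE /A1/= in_itv/= andbT => Z1w; rewrite ger0_norm.
  rewrite Z10// add0e (eq_integral (fun w => (-1)%:E * (Z1 w)%:E)%E); last first.
    by move=> w; rewrite inE /A2/= in_itv/= => Z1w; rewrite ltr0_norm// mulN1e EFinN.
  rewrite integralZl; first by rewrite Z10// mule0.
    exact: Gm.
  by apply: integrableS iZ1 => //; exact: Gm.
move=> Z1ae.
(* [Z2] may be negative on a null set and [sigma^2] need not be integrable; the positive part allows
   the comparison of non-negative integrals. *)
apply: le_trans (_ : \int[P]_(w in A) (Num.max (Z2 w) 0)%:E <= _)%E.
  apply: le_integral => //.
  - by apply: integrableS iZ2.
  - apply: (@integrableS _ _ _ P setT) => //.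
    have := integrable_funepos measurableT iZ2; congr (P.-integrable _ _).
    by apply/funext => w; rewrite funeposE /= EFin_max.
  - by move=> w _; rewrite lee_fin le_max lexx.
apply: ae_ge0_le_integral => //.
- by move=> w _; rewrite lee_fin le_max lexx orbT.
- apply: measurable_funTS; apply/measurable_EFinP.
  by apply: measurable_maxr => //; exact: mwT.
- by move=> w _; rewrite lee_fin sqr_ge0.
- by apply: measurable_funTS; apply/measurable_EFinP; apply: measurable_funX; exact: mwT.
move: Z12 Z1ae; apply: filterS2 => w Z12 /(_ I)[Z1w] _.
rewrite lee_fin ge_max sqr_ge0 andbT; apply: le_trans Z12.
by rewrite Z1w expr0n subr0.
Qed.

(** With [D = Dp - Dn], adding [B |D|] to both sides turns [eps D] into
    [(B + eps) Dp + (B - eps) Dn], which is non-negative and has the integral of [B |D|] as an upper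
    bound. That integral is finite, since [|D| <= K], so it cancels at the end. *)
Lemma integral_cond_step (c D z U : T -> R) (K : R) :
  measurable_wrt G c -> measurable_wrt G D -> measurable_wrt G z ->
  measurable_fun setT U ->
  (forall w, 0 <= c w) -> (forall w, 0 <= z w) -> (forall w, `|D w| <= K) ->
  (forall w, 0 <= U w <= c w + eps w * D w + eps w ^+ 2 * z w) ->
  (\int[P]_w (U w)%:E <= \int[P]_w (c w + sigma w ^+ 2 * z w)%:E)%E.
Proof.
move=> mc mD mz mU c0 z0 DK U0.
pose Dp w := (`|D w| + D w) / 2; pose Dn w := (`|D w| - D w) / 2.
have mDG : measurable_fun setT (D : g_sigma_algebraType G -> R).
  exact/measurable_wrtP.
have mDp : measurable_wrt G Dp.
  apply/measurable_wrtP => //; apply: measurable_funM => //.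
  by apply: measurable_funD => //; exact: measurableT_comp.
have mDn : measurable_wrt G Dn.
  apply/measurable_wrtP => //; apply: measurable_funM => //.
  by apply: measurable_funB => //; exact: measurableT_comp.
have Dp0 w : 0 <= Dp w.
  by rewrite /Dp; have := ler_norm (- D w); rewrite normrN; lra.
have Dn0 w : 0 <= Dn w by rewrite /Dn; have := ler_norm (D w); lra.
have DE w : D w = Dp w - Dn w by rewrite /Dp /Dn; field.
have DnE w : `|D w| = Dp w + Dn w by rewrite /Dp /Dn; field.
have eBw w : 0 <= B + 1 * eps w /\ 0 <= B + -1 * eps w.
  by have := eB w; rewrite ler_norml => /andP[]; split; lra.
have mcT := mwT mc; have mDT := mwT mD; have mzT := mwT mz; have msT := mwT ms.
have mDpT := mwT mDp; have mDnT := mwT mDn.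
have maf k : measurable_fun setT (fun w => B + k * eps w).
  by apply: measurable_funD => //; apply: measurable_funM.
have h1 : (\int[P]_w ((B + 1 * eps w) * Dp w)%:E <= \int[P]_w (B * Dp w)%:E)%E.
  apply: (le_integral_sub (G := G) (f := fun w => B + 1 * eps w) (g := fun=> B)) => //.
  - by move=> w; case: (eBw w).
  - by move=> _; exact: ltW.
  - by move=> A GA; rewrite condexp_zero_affine.
have h2 : (\int[P]_w ((B + -1 * eps w) * Dn w)%:E <= \int[P]_w (B * Dn w)%:E)%E.
  apply: (le_integral_sub (G := G) (f := fun w => B + -1 * eps w) (g := fun=> B)) => //.
  - by move=> w; case: (eBw w).
  - by move=> _; exact: ltW.
  - by move=> A GA; rewrite condexp_zero_affine.
have h3 : (\int[P]_w (eps w ^+ 2 * z w)%:E <= \int[P]_w (sigma w ^+ 2 * z w)%:E)%E.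
  apply: (le_integral_sub (G := G) (f := fun w => eps w ^+ 2)
    (g := fun w => sigma w ^+ 2)) => //.
  - exact: measurable_funX.
  - exact: measurable_funX.
  - by move=> w; rewrite sqr_ge0.
  - by move=> w; rewrite sqr_ge0.
  - exact: condvar_le_integral.
have mM (f g : T -> R) : measurable_fun setT f -> measurable_fun setT g ->
    measurable_fun setT (fun w => (f w * g w)%:E).
  by move=> mf mg; apply/measurable_EFinP; exact: measurable_funM.
have mE (f : T -> R) : measurable_fun setT f -> measurable_fun setT (fun w => (f w)%:E).
  by move=> mf; exact/measurable_EFinP.
have fin : (\int[P]_w (B * `|D w|)%:E \is a fin_num)%E.
  rewrite ge0_fin_numE; last by apply: integral_ge0 => w _; rewrite lee_fin mulr_ge0// ltW.
  apply: le_lt_trans (_ : \int[P]_w (B * K)%:E < +oo)%E.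
    apply: ge0_le_integral => //.
    - by move=> w _; rewrite lee_fin mulr_ge0// ltW.
    - by apply: mM => //; exact: measurableT_comp.
    - by move=> w _; rewrite lee_fin; apply: ler_wpM2l; rewrite // ltW.
  by rewrite integral_cst//= probability_setT mule1 ltry.
rewrite -(leeD2rE _ _ fin).
have iD (f g : T -> R) : measurable_fun setT f -> measurable_fun setT g ->
    (forall w, 0 <= f w) -> (forall w, 0 <= g w) ->
    (\int[P]_w (f w)%:E + \int[P]_w (g w)%:E = \int[P]_w (f w + g w)%:E)%E.
  move=> mf mg f0 g0; rewrite -ge0_integralD//.
  - by move=> w _; rewrite lee_fin.
  - exact: mE.
  - by move=> w _; rewrite lee_fin.
  - exact: mE.
have B0' := ltW B0.
have mDa : measurable_fun setT (fun w => B * `|D w|).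
  by apply: measurable_funM => //; exact: measurableT_comp.
have Da0 w : 0 <= B * `|D w| by rewrite mulr_ge0.
have mBp : measurable_fun setT (fun w => B * Dp w) by exact: measurable_funM.
have mBn : measurable_fun setT (fun w => B * Dn w) by exact: measurable_funM.
have msz : measurable_fun setT (fun w => sigma w ^+ 2 * z w).
  by apply: measurable_funM => //; exact: measurable_funX.
have mez : measurable_fun setT (fun w => eps w ^+ 2 * z w).
  by apply: measurable_funM => //; exact: measurable_funX.
have mep : measurable_fun setT (fun w => (B + 1 * eps w) * Dp w).
  exact: measurable_funM.
have men : measurable_fun setT (fun w => (B + -1 * eps w) * Dn w).
  exact: measurable_funM.
have sz0 w : 0 <= sigma w ^+ 2 * z w by rewrite mulr_ge0 ?sqr_ge0.
have ez0 w : 0 <= eps w ^+ 2 * z w by rewrite mulr_ge0 ?sqr_ge0.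
have Bp0 w : 0 <= B * Dp w by exact: mulr_ge0.
have Bn0 w : 0 <= B * Dn w by exact: mulr_ge0.
have ep0 w : 0 <= (B + 1 * eps w) * Dp w by apply: mulr_ge0 => //; case: (eBw w).
have en0 w : 0 <= (B + -1 * eps w) * Dn w by apply: mulr_ge0 => //; case: (eBw w).
have U0' w : 0 <= U w by case/andP: (U0 w).
have -> : (\int[P]_w (c w + sigma w ^+ 2 * z w)%:E + \int[P]_w (B * `|D w|)%:E =
  \int[P]_w (c w)%:E + \int[P]_w (sigma w ^+ 2 * z w)%:E +
  (\int[P]_w (B * Dp w)%:E + \int[P]_w (B * Dn w)%:E))%E.
  rewrite (iD _ _ mcT msz c0 sz0) (iD _ _ mBp mBn Bp0 Bn0); congr (_ + _)%E.
  by apply: eq_integral => w _; rewrite DnE mulrDr.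
apply: le_trans (leeD (leeD (lexx _) h3) (leeD h1 h2)).
rewrite (iD _ _ mcT mez c0 ez0) (iD _ _ mep men ep0 en0) (iD _ _ mU mDa U0' Da0).
have mce := measurable_funD mcT mez; have mpn := measurable_funD mep men.
rewrite (iD _ _ mce mpn); last 2 first.
- by move=> w; exact: addr_ge0.
- by move=> w; exact: addr_ge0.
apply: ge0_le_integral => //.
- by move=> w _; rewrite lee_fin addr_ge0.
- by apply: mE; exact: measurable_funD.
- by apply: mE; exact: measurable_funD.
move=> w _; rewrite lee_fin DnE /=.
by have /andP[_] := U0 w; rewrite {1}DE; lra.
Qed.

End conditional_step.

(** * Measurability of real-valued expressions *)

Section real_measurability.
Context {d : measure_display} {S : measurableType d} {R : realType}.
Implicit Types f g : S -> R.

Lemma measurable_fun_inv f : measurable_fun setT f -> (forall w, 0 <= f w) ->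
  measurable_fun setT (fun w => (f w)^-1).
Proof.
move=> mf f0; have -> : (fun w => (f w)^-1) = (fun w => f w `^ (-1)).
  by apply/funext => w; rewrite powR_inv1.
by apply: (measurableT_comp (measurable_powR (-1))).
Qed.

Lemma measurable_fun_sqrt f : measurable_fun setT f -> (forall w, 0 <= f w) ->
  measurable_fun setT (fun w => Num.sqrt (f w)).
Proof.
move=> mf f0; have -> : (fun w => Num.sqrt (f w)) = (fun w => f w `^ 2^-1).
  by apply/funext => w; rewrite powR12_sqrt.
by apply: (measurableT_comp (measurable_powR 2^-1)).
Qed.

Lemma measurable_fun_powR f g : measurable_fun setT f -> measurable_fun setT g ->
  measurable_fun setT (fun w => f w `^ g w).
Proof.
move=> mf mg; rewrite /powR; apply: measurable_fun_ifT.
- exact: measurable_fun_eqr.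
- have -> : (fun w => (g w == 0)%:R) = (fun w => if g w == 0 then 1 else 0 : R).
    by apply/funext => w; case: eqP.
  by apply: measurable_fun_ifT => //; exact: measurable_fun_eqr.
- apply: (measurableT_comp (@measurable_expR R)); apply: measurable_funM => //.
  exact: (measurableT_comp (@measurable_ln R)).
Qed.

Lemma measurable_fun_expR f : measurable_fun setT f ->
  measurable_fun setT (fun w => expR (f w)).
Proof. by move=> mf; exact: (measurableT_comp (@measurable_expR R)). Qed.

Lemma measurable_fun_coshR f : measurable_fun setT f ->
  measurable_fun setT (fun w => coshR (f w)).
Proof.
move=> mf; apply: measurable_funM => //; apply: measurable_funD.
  exact: measurable_fun_expR.
by apply: measurable_fun_expR; exact: measurable_funN.
Qed.

Lemma measurable_fun_sinhR f : measurable_fun setT f ->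
  measurable_fun setT (fun w => sinhR (f w)).
Proof.
move=> mf; apply: measurable_funM => //; apply: measurable_funB.
  exact: measurable_fun_expR.
by apply: measurable_fun_expR; exact: measurable_funN.
Qed.

Lemma measurable_fun_sum_nat (h : nat -> S -> R) m n :
  (forall i, (m <= i < n)%N -> measurable_fun setT (h i)) ->
  measurable_fun setT (fun w => \sum_(m <= i < n) h i w).
Proof.
move=> mh; under eq_fun do rewrite big_nat_cond big_mkcond.
apply: measurable_sum => i.
by case: (boolP ((m <= i < n)%N && true)) => // /andP[/mh].
Qed.

End real_measurability.

(** * Weakly measurable vectors and measurability of the quadratic forms *)

Section weak_measurability.
Variables (R : realType) (H : lmodType R) (inner : H -> H -> R) (rho : R).
Hypothesis hH : is_separable_hilbert inner.
Hypothesis rho0 : 0 < rho.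
Context {d : measure_display} {S : measurableType d}.
Implicit Types X Y : S -> H.

Let iP := inner_psd hH.

Definition wmeas X := forall h, measurable_fun setT (fun w => inner h (X w)).

Lemma wmeasD X Y : wmeas X -> wmeas Y -> wmeas (fun w => X w + Y w).
Proof.
move=> mX mY h; under eq_fun do rewrite (formDr iP); exact: measurable_funD.
Qed.

Lemma wmeasZ (f : S -> R) X : measurable_fun setT f -> wmeas X ->
  wmeas (fun w => f w *: X w).
Proof.
move=> mf mX h; under eq_fun do rewrite (formZr iP); exact: measurable_funM.
Qed.

Lemma wmeas_sum_nat (X : nat -> S -> H) m n :
  (forall i, (m <= i < n)%N -> wmeas (X i)) ->
  wmeas (fun w => \sum_(m <= i < n) X i w).
Proof.
move=> mX h; under eq_fun do rewrite (form_sumr iP).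
by apply: measurable_fun_sum_nat => i /mX; exact.
Qed.

(* [|X|^2] is the supremum over a dense sequence [a_n] of the weakly measurable
   quantities [|X|^2 - |X - a_n|^2 = 2 <a_n, X> - |a_n|^2]. *)
Lemma measurable_sqr_norm X : wmeas X ->
  measurable_fun setT (fun w => inner (X w) (X w)).
Proof.
move=> mX; have [_ _ _ _ [a aP]] := hH.
apply: (measurability _ (RGenOInfty.measurableE R)) => //.
move=> _ [_ [r ->] <-]; rewrite setTI.
have -> : (fun w => inner (X w) (X w)) @^-1` `]r, +oo[ =
  \bigcup_n (fun w => 2 * inner (a n) (X w) - inner (a n) (a n)) @^-1` `]r, +oo[.
  have E w n : 2 * inner (a n) (X w) - inner (a n) (a n) =
    inner (X w) (X w) - hnorm inner (X w - a n) ^+ 2.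
    by rewrite (sqr_hnorm iP) !(formE iP) (formC iP (X w) (a n)); ring.
  apply/seteqP; split=> w /=.
    rewrite in_itv/= andbT => rX.
    have e0 : 0 < Num.sqrt (inner (X w) (X w) - r) by rewrite sqrtr_gt0 subr_gt0.
    have [n Xn] := aP (X w) _ e0; exists n => //=.
    rewrite in_itv/= andbT E ltrBrDl -ltrBrDr.
    rewrite -[ltRHS]sqr_sqrtr ?subr_ge0 1?ltW//.
    by rewrite ltr_pXn2r// ?nnegrE ?sqrtr_ge0.
  move=> [n _ /=]; rewrite !in_itv/= !andbT E => /lt_le_trans; apply.
  by rewrite lerBlDr lerDl sqr_ge0.
apply: bigcup_measurable => n _; rewrite -[X in measurable X]setTI.
suff : measurable_fun setT (fun w => 2 * inner (a n) (X w) - inner (a n) (a n)) by exact.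
by apply: measurable_funB => //; apply: measurable_funM.
Qed.

Lemma measurable_inner X Y : wmeas X -> wmeas Y ->
  measurable_fun setT (fun w => inner (X w) (Y w)).
Proof.
move=> mX mY.
have -> : (fun w => inner (X w) (Y w)) = (fun w =>
  (inner (X w + Y w) (X w + Y w) - inner (X w) (X w) - inner (Y w) (Y w)) / 2).
  by apply/funext => w; rewrite !(formE iP) (formC iP (Y w) (X w)); field.
apply: measurable_funM => //; apply: measurable_funB; last exact: measurable_sqr_norm.
apply: measurable_funB; last exact: measurable_sqr_norm.
by apply: measurable_sqr_norm; exact: wmeasD.
Qed.

Lemma measurable_qform (X : nat -> S -> H) t U W :
  (forall i, (0 < i <= t)%N -> wmeas (X i)) -> wmeas U -> wmeas W ->
  measurable_fun setT (fun w => qform inner rho (X^~ w) t (U w) (W w)).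
Proof.
(* The arguments are generalized because the recursion also evaluates the form at [X t.+1]. *)
elim: t U W => [|t IH] U W mX mU mW.
  under eq_fun do rewrite (qform0 _ hH).
  by apply: measurable_funM => //; exact: measurable_inner.
have mXt i : (0 < i <= t)%N -> wmeas (X i).
  by move=> /andP[i0 it]; apply: mX; rewrite i0 (leq_trans it).
have mX1 : wmeas (X t.+1) by apply: mX; rewrite leqnn.
under eq_fun do rewrite (qformS hH rho0).
apply: measurable_funB; first exact: IH.
apply: measurable_funM; first by apply: measurable_funM; exact: IH.
apply: measurable_fun_inv.
  by apply: measurable_funD => //; exact: IH.
by move=> w; rewrite addr_ge0// (form_ge0 (qform_psd hH rho0 _ _)).
Qed.

End weak_measurability.

(** * The self-normalized process and its [cosh] supermartingale *)

Section process.
Variables (R : realType) (H : lmodType R) (inner : H -> H -> R).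
Context {d : measure_display} {T : measurableType d}.
Variables (P : probability T R) (F : nat -> set_system T).
Variables (X : nat -> T -> H) (eps sigma : nat -> T -> R) (B rho : R).
Hypothesis hH : is_separable_hilbert inner.
Hypothesis FP : filtration F.
Hypothesis B0 : 0 < B.
Hypothesis hyp : forall t, (0 < t)%N ->
     [/\ Hmeasurable_wrt inner (F t.-1) (X t),
         measurable_wrt (F t) (eps t),
         condexp_zero P (F t.-1) (eps t),
         (forall w, `|eps t w| <= B)
       & condvar_le P (F t.-1) (eps t) (sigma t) /\ measurable_wrt (F t.-1) (sigma t)].
Hypothesis rho0 : 0 < rho.

Local Notation q t w := (qform inner rho (fun i => X i w) t).
Local Notation M t w := (Mt (fun i => X i w) (fun i => eps i w) t).
Local Notation S t w := (s_t inner rho (fun i => X i w) (fun i => eps i w) t).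
Local Notation N t w := (nu_t inner rho (fun i => X i w) (fun i => sigma i w) t).
Local Notation FT t := (g_sigma_algebraType (F t)).

Let sF t : sigma_algebra setT (F t). Proof. by case: FP. Qed.
Let Fm t : F t `<=` measurable. Proof. by case: FP. Qed.
Let qP t w := qform_psd hH rho0 (fun i => X i w) t.

(** The index [t.+1] is included by predictability; through it the forms and [nu] at time [t.+1] are
    already [F t]-measurable. *)
Lemma process_wmeas i t : (0 < i <= t.+1)%N -> wmeas inner (X i : FT t -> H).
Proof.
move=> /andP[i0 it] h; apply/(measurable_wrtP _ (sF t)).
apply: (measurable_fun_filtration FP (s := i.-1)); first by case: i i0 it.
by have [mX _ _ _ _] := hyp i0; exact: mX.
Qed.

Lemma wmeas_Mt s t : (s <= t)%N -> wmeas inner ((fun w => M s w) : FT t -> H).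
Proof.
move=> st; apply: (wmeas_sum_nat hH) => i /andP[i0]; rewrite ltnS => it.
apply: (wmeasZ hH); last by apply: process_wmeas; rewrite i0 (leq_trans it)// (leq_trans st).
apply/(measurable_wrtP _ (sF t)); apply: (measurable_fun_filtration FP (leq_trans it st)).
by have [] := hyp i0.
Qed.

Lemma measurable_q s t (U W : FT t -> H) : (s <= t.+1)%N ->
  wmeas inner U -> wmeas inner W ->
  measurable_fun setT ((fun w => q s w (U w) (W w)) : FT t -> R).
Proof.
move=> st mU mW.
apply: (measurable_qform hH rho0 (X := X : nat -> FT t -> H)) => // i /andP[i0 it].
by apply: process_wmeas; rewrite i0 (leq_trans it).
Qed.

Lemma measurable_s_t t : measurable_fun setT ((fun w => S t w) : FT t -> R).
Proof.
under eq_fun do rewrite (s_tE hH rho0).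
apply: measurable_fun_sqrt; last by move=> w; exact: (form_ge0 (qP _ _)).
by apply: measurable_q => //; exact: wmeas_Mt.
Qed.

Lemma measurable_nu_t s t : (s <= t.+1)%N ->
  measurable_fun setT ((fun w => N s w) : FT t -> R).
Proof.
move=> st; apply: measurable_fun_sum_nat => i /andP[i0]; rewrite ltnS => is'.
have it : (i <= t.+1)%N := leq_trans is' st.
apply: measurable_funM.
  apply: measurable_funX; apply/(measurable_wrtP _ (sF t)).
  apply: (measurable_fun_filtration FP (s := i.-1)); first by case: i i0 it {is'}.
  by have [_ _ _ _ []] := hyp i0.
under eq_fun do rewrite (sqr_hnorm_G_t hH rho0).
by apply: measurable_q => //; apply: process_wmeas; rewrite i0.
Qed.

Lemma nu_tS t w : N t.+1 w = N t w + sigma t.+1 w ^+ 2 * q t.+1 w (X t.+1 w) (X t.+1 w).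
Proof. by rewrite /nu_t big_nat_recr//= (sqr_hnorm_G_t hH rho0). Qed.

Lemma nu_t_ge0 t w : 0 <= N t w.
Proof. by apply: sumr_ge0 => i _; rewrite mulr_ge0// sqr_ge0. Qed.

Lemma MtS t w : M t.+1 w = M t w + eps t.+1 w *: X t.+1 w.
Proof. by rewrite /Mt big_nat_recr. Qed.

Lemma s_tS t w : S t.+1 w = Num.sqrt (q t.+1 w (M t w) (M t w) +
  2 * eps t.+1 w * q t.+1 w (M t w) (X t.+1 w) +
  eps t.+1 w ^+ 2 * q t.+1 w (X t.+1 w) (X t.+1 w)).
Proof.
rewrite (s_tE hH rho0) MtS !(formE (qP t.+1 w)); congr Num.sqrt.
by rewrite (formC (qP t.+1 w) (X _ _) (M _ _)); ring.
Qed.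

Lemma sqrt_q_le t w : Num.sqrt (q t.+1 w (M t w) (M t w)) <= S t w.
Proof. by rewrite (s_tE hH rho0) ler_wsqrtr// (qformS_le hH rho0). Qed.

(** Each step adds at most [|eps G| <= B]. This deterministic bound makes the coefficient of [eps]
    in the one-step inequality bounded. *)
Lemma s_t_le t w : S t w <= t%:R * B.
Proof.
elim: t => [|t IH].
  by rewrite (s_tE hH rho0) /Mt big_nil (form0l (qP 0 w)) sqrtr0 mul0r.
rewrite (s_tE hH rho0) MtS -/(hnorm (q t.+1 w) _).
apply: le_trans (hnormD (qP t.+1 w) _ _) _; rewrite -natr1 mulrDl mul1r lerD//.
  by apply: le_trans (sqrt_q_le t w) IH.
rewrite (hnormZ (qP t.+1 w)) -[leRHS]mulr1; apply: ler_pM => //.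
- exact: hnorm_ge0.
- by have [_ _ _ + _] := hyp (ltn0Sn t); exact.
- by rewrite -sqrtr1 ler_wsqrtr// (qform_last_le1 hH rho0).
Qed.

Definition cosh_process (lam : R) t w :=
  coshR (lam * S t w) * expR (- (N t w * bpsi B lam)).

Lemma cosh_process_ge0 lam t w : 0 <= cosh_process lam t w.
Proof. by rewrite mulr_ge0 ?coshR_ge0 ?expR_ge0. Qed.

(** The supermartingale property, tested against bounded weights; the weight used later is an
    indicator times the mixing density. *)
Lemma cosh_process_step (lam : R) t (a : T -> R) (Ka : R) : 0 <= lam ->
  measurable_wrt (F t) a -> (forall w, 0 <= a w <= Ka) ->
  (\int[P]_w (a w * cosh_process lam t.+1 w)%:E <=
   \int[P]_w (a w * cosh_process lam t w)%:E)%E.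
Proof.
move=> lam0 ma aK.
have [_ me e0 eB [es ms]] := hyp (ltn0Sn t); rewrite /= in e0 es ms.
have a0 w : 0 <= a w by case/andP: (aK w).
(* With [y = (rho I + V_t+1)^(-1/2) M_t], these are [|y|^2], [<y, G_t+1>] and [|G_t+1|^2]. *)
pose p w := q t.+1 w (M t w) (M t w).
pose m w := q t.+1 w (M t w) (X t.+1 w).
pose g w := q t.+1 w (X t.+1 w) (X t.+1 w).
pose W w := expR (- (N t.+1 w * bpsi B lam)).
pose C w := coshR (lam * Num.sqrt (p w)).
have psi0 := bpsi_ge0 B lam.
have p0 w : 0 <= p w by exact: (form_ge0 (qP _ _)).
have g01 w : 0 <= g w <= 1.
  by rewrite (form_ge0 (qP _ _)) (qform_last_le1 hH rho0).
have mpg w : m w ^+ 2 <= p w * g w by exact: (form_cauchy_schwarz (qP _ _)).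
have W0 w : 0 <= W w by exact: expR_ge0.
have W1 w : W w <= 1.
  by rewrite /W -expR0 ler_expR oppr_le0 mulr_ge0// nu_t_ge0.
have C0 w : 0 <= C w by exact: coshR_ge0.
have CS w : C w <= coshR (lam * S t w).
  by apply: coshR_homo; rewrite mulr_ge0 ?sqrtr_ge0//= ler_wpM2l// sqrt_q_le.
have CK w : C w <= coshR (lam * (t%:R * B)).
  apply: le_trans (CS w) _; apply: coshR_homo.
  by rewrite mulr_ge0 ?hnorm_ge0//= ler_wpM2l// s_t_le.
have wX : wmeas inner (X t.+1 : FT t -> H) by apply: process_wmeas; rewrite /= leqnn.
have wM := wmeas_Mt (leqnn t).
have maF : measurable_fun setT (a : FT t -> R) by exact/(measurable_wrtP _ (sF t)).
have mp : measurable_fun setT (p : FT t -> R) by exact: measurable_q.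
have mm : measurable_fun setT (m : FT t -> R) by exact: measurable_q.
have mg : measurable_fun setT (g : FT t -> R) by exact: measurable_q.
have mW : measurable_fun setT (W : FT t -> R).
  apply: measurable_fun_expR; apply: measurable_funN; apply: measurable_funM => //.
  exact: measurable_nu_t.
have msp : measurable_fun setT ((fun w => Num.sqrt (p w)) : FT t -> R).
  exact: measurable_fun_sqrt.
have mC : measurable_fun setT (C : FT t -> R).
  by apply: measurable_fun_coshR; exact: measurable_funM.
have mD : measurable_fun setT ((fun w => cosh_slope lam (p w) (m w)) : FT t -> R).
  apply: measurable_funM; last first.
    by apply: measurable_fun_inv => // w; exact: sqrtr_ge0.
  apply: measurable_funM; first exact: measurable_funM.
  by apply: measurable_fun_sinhR; exact: measurable_funM.
have maW := measurable_funM maF mW.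
(* The coefficients of [1], [eps] and [eps^2] in the bound of [coshR_step], all [F t]-measurable. *)
pose c w := a w * W w * C w.
pose D w := a w * W w * cosh_slope lam (p w) (m w).
pose z w := a w * W w * (C w * (g w * bpsi B lam)).
have g0 w : 0 <= g w by case/andP: (g01 w).
have c0 w : 0 <= c w := mulr_ge0 (mulr_ge0 (a0 w) (W0 w)) (C0 w).
have z0 w : 0 <= z w :=
  mulr_ge0 (mulr_ge0 (a0 w) (W0 w)) (mulr_ge0 (C0 w) (mulr_ge0 (g0 w) psi0)).
apply: (@le_trans _ _ (\int[P]_w (c w + sigma t.+1 w ^+ 2 * z w)%:E)%E).
apply: (integral_cond_step (sF t) (@Fm t) B0 e0 eB es ms (D := D)
    (K := Ka * (lam * coshR (lam * (t%:R * B))))).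
- apply/(measurable_wrtP _ (sF t)); exact: measurable_funM.
- apply/(measurable_wrtP _ (sF t)); exact: measurable_funM.
- apply/(measurable_wrtP _ (sF t)); apply: measurable_funM => //.
  by apply: measurable_funM => //; exact: measurable_funM.
- apply: (measurable_fun_sub (sF t.+1) (@Fm t.+1)); apply: measurable_funM.
    by apply/(measurable_wrtP _ (sF t.+1)); exact: (measurable_fun_filtration FP (leqnSn t)).
  apply: measurable_funM.
    by apply: measurable_fun_coshR; apply: measurable_funM => //; exact: measurable_s_t.
  apply: measurable_fun_expR; apply: measurable_funN; apply: measurable_funM => //.
  exact: measurable_nu_t.
- exact: c0.
- exact: z0.
- move=> w; rewrite /D normrM ger0_norm ?mulr_ge0//.
  apply: ler_pM => //; first by rewrite mulr_ge0.
    by have /andP[_] := aK w; apply: le_trans; rewrite ler_piMr.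
  apply: le_trans (cosh_slope_le lam0 (p0 w) (g01 w) (mpg w)) _.
  by apply: ler_wpM2l => //; exact: CK.
- move=> w; rewrite (mulr_ge0 (a0 w) (cosh_process_ge0 _ _ _))/= /cosh_process.
  rewrite s_tS -/(p w) -/(m w) -/(g w).
  have := coshR_step lam0 B0 (p0 w) (g01 w) (mpg w) (eB w).
  rewrite /c /D /z -/(C w) -/(W w) => /(ler_wpM2l (mulr_ge0 (a0 w) (W0 w))) h.
  have -> : a w * (coshR (lam * Num.sqrt (p w + 2 * eps t.+1 w * m w +
      eps t.+1 w ^+ 2 * g w)) * W w) = a w * W w * coshR (lam * Num.sqrt (p w +
      2 * eps t.+1 w * m w + eps t.+1 w ^+ 2 * g w)) by ring.
  by apply: le_trans h _; rewrite le_eqVlt; apply/orP; left; apply/eqP; ring.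
apply: ge0_le_integral => //.
- move=> w _; rewrite lee_fin (addr_ge0 (c0 w))// (mulr_ge0 (sqr_ge0 _))//.
- apply/measurable_EFinP; apply: (measurable_fun_sub (sF t) (@Fm t)).
  apply: measurable_funD; first exact: measurable_funM.
  apply: measurable_funM.
    by apply: measurable_funX; exact/(measurable_wrtP _ (sF t)).
  by apply: measurable_funM => //; apply: measurable_funM => //; exact: measurable_funM.
- apply/measurable_EFinP; apply: (measurable_fun_sub (sF t) (@Fm t)).
  apply: measurable_funM => //; apply: measurable_funM.
    by apply: measurable_fun_coshR; apply: measurable_funM => //; exact: measurable_s_t.
  apply: measurable_fun_expR; apply: measurable_funN; apply: measurable_funM => //.
  exact: measurable_nu_t.
move=> w _; rewrite lee_fin /cosh_process /c /z.
have -> : a w * W w * C w + sigma t.+1 w ^+ 2 * (a w * W w * (C w * (g w * bpsi B lam))) =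
  a w * (C w * (W w * (1 + sigma t.+1 w ^+ 2 * g w * bpsi B lam))) by ring.
apply: ler_wpM2l => //; apply: ler_pM => //.
  by rewrite (mulr_ge0 (W0 w))// addr_ge0// (mulr_ge0 (mulr_ge0 (sqr_ge0 _) (g0 w))).
(* [1 + x <= exp x], where [x = sigma^2 |G|^2 psi] is exactly what the increment of [nu] adds to the
   exponent. *)
rewrite /W nu_tS -/(g w) mulrDl opprD expRD -mulrA ler_piMr ?expR_ge0//.
by rewrite expRN mulrC ler_pdivrMr ?expR_gt0// mul1r expR_ge1Dx.
Qed.

End process.

(** * Incomplete gamma integrals: rescaling, bounds and measurability *)

Section incomplete_gamma.
Variable R : realType.
Local Notation mu := (@lebesgue_measure R).
Implicit Types a x p : R.

Lemma continuous_gamma_kernel p (u : R) : 0 < u ->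
  {for u, continuous (fun u : R => expR (p * ln u - u))}.
Proof.
move=> u0; apply: continuous_comp; last exact: continuous_expR.
apply: continuousB; last exact: cvg_id.
by apply: continuousM; [exact: cst_continuous|exact: continuous_ln].
Qed.

Lemma powR_kernelE a (u : R) : 0 < u ->
  u `^ (a - 1) * expR (- u) = expR ((a - 1) * ln u - u).
Proof. by move=> u0; rewrite /powR gt_eqF// expRD. Qed.

Lemma gamma_kernel_scale p x : 0 < x ->
  (\int[mu]_(u in `[x, +oo[) (expR (p * ln u - u))%:E =
   \int[mu]_(v in `[1%R, +oo[) (expR (p * ln (x * v) - x * v) * x)%:E)%E.
Proof.
move=> x0.
have D1 : derive1 ( *%R x) = cst x.
  apply/funext => v; rewrite derive1E.
  have -> : *%R x = (cst x * id : R -> R) by [].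
  by rewrite deriveM// derive_cst derive_id scaler0 addr0 /GRing.scale/= mulr1.
have := @increasing_ge0_integration_by_substitutiony R ( *%R x)
  (fun u => expR (p * ln u - u)) 1.
rewrite D1 mulr1 => ->//.
- by move=> u v _ _; rewrite ltr_pM2l.
- by move=> v _; exact: cst_continuous.
- exact: is_cvg_cst.
- exact: is_cvg_cst.
- split=> [v _|]; first exact: derivableM.
  by apply: cvg_at_right_filter; apply: continuousM; [exact: cst_continuous|exact: cvg_id].
- apply/cvgryPge => A; near=> v.
  have : x^-1 * A <= v by near: v; apply: nbhs_pinfty_ge; exact: num_real.
  by rewrite ler_pdivrMl.
- apply: continuous_in_subspaceT => u; rewrite inE/= in_itv/= andbT => xu.
  by apply: continuous_gamma_kernel; exact: lt_le_trans xu.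
Unshelve. all: by end_near. Qed.

(** [x^(-a)] times the upper incomplete gamma function, that is the generalized exponential integral
    of order [1 - a]. The domain no longer depends on [x], and the value may be infinite. *)
Definition tail_integral a x : \bar R :=
  (\int[mu]_(v in `[1%R, +oo[) (expR ((a - 1) * ln v - x * v))%:E)%E.

Lemma tail_integral_ge0 a x : (0 <= tail_integral a x)%E.
Proof. by apply: integral_ge0 => v _; rewrite lee_fin expR_ge0. Qed.

(** At [y = +oo] both sides are the default value 0. *)
Lemma fine_scale (r : R) (y : \bar R) : 0 < r -> (0 <= y)%E ->
  fine (r%:E * y)%E = r * fine y.
Proof.
move=> r0; case: y => [y||]// _.
by rewrite gt0_muley//= mulr0.
Qed.

Lemma upper_gammaE a x : 0 < x ->
  upper_gamma a x = x `^ a * fine (tail_integral a x).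
Proof.
move=> x0; rewrite -fine_scale ?powR_gt0 ?tail_integral_ge0// /upper_gamma /Rintegral.
congr fine.
have -> : [set u | x <= u] = `[x, +oo[%classic :> set R.
  by apply/seteqP; split=> u /=; rewrite in_itv/= andbT.
transitivity (\int[mu]_(u in `[x, +oo[) (expR ((a - 1) * ln u - u))%:E)%E.
  apply: eq_integral => u; rewrite inE/= in_itv/= andbT => xu.
  by rewrite powR_kernelE//; exact: lt_le_trans xu.
rewrite gamma_kernel_scale// /tail_integral -ge0_integralZl_EFin ?powR_ge0//.
- apply: eq_integral => v; rewrite inE/= in_itv/= andbT => v1.
  have v0 : 0 < v by exact: lt_le_trans v1.
  have xE : x = expR (ln x) by rewrite lnK.
  rewrite -EFinM lnM ?posrE// /powR gt_eqF//; congr EFin.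
  by rewrite [X in _ * X = _]xE -!expRD; congr expR; ring.
- apply/measurable_EFinP; apply: measurable_funTS; apply: measurable_fun_expR.
  by apply: measurable_funB; apply: measurable_funM.
Qed.

Lemma Gamma_fn_ge0 a : 0 <= Gamma_fn a.
Proof. by apply: Rintegral_ge0 => u _; rewrite mulr_ge0 ?powR_ge0 ?expR_ge0. Qed.

Lemma upper_gamma_ge0 a x : 0 <= upper_gamma a x.
Proof. by apply: Rintegral_ge0 => u _; rewrite mulr_ge0 ?powR_ge0 ?expR_ge0. Qed.

Lemma Gamma_reg_upper_gamma_bound a x :
  0 <= Gamma_fn a * reg_upper_gamma a x <= upper_gamma a x.
Proof.
rewrite /reg_upper_gamma mulrCA.
have [->|G0] := eqVneq (Gamma_fn a) 0.
  by rewrite mul0r mulr0 lexx upper_gamma_ge0.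
by rewrite mulfV// mulr1 lexx upper_gamma_ge0.
Qed.

(* An inequality and not an equation, so that nothing is claimed about the
   finiteness of the Gamma integrals: [x / 0 = 0], and divergent integrals are [0]. *)
Lemma gamma_ratio_le (c a x e : R) : 0 < c -> 0 < x -> 0 <= e ->
  c `^ c / (Gamma_fn c * reg_upper_gamma c c)
  * (Gamma_fn a * reg_upper_gamma a x / x `^ a) * e <=
  (fine (tail_integral c c))^-1 * (e * fine (tail_integral a x)).
Proof.
move=> c0 x0 e0; set m := fine (tail_integral c c).
have m0 : 0 <= m by apply: fine_ge0; exact: tail_integral_ge0.
have /andP[Ga0 Ga] := Gamma_reg_upper_gamma_bound a x.
have /andP[? ?] : 0 <= Gamma_fn a * reg_upper_gamma a x / x `^ a <=
    fine (tail_integral a x).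
  rewrite divr_ge0 ?powR_ge0//= ler_pdivrMr ?powR_gt0//.
  by apply: le_trans Ga _; rewrite upper_gammaE// mulrC.
have /andP[? ?] : 0 <= c `^ c / (Gamma_fn c * reg_upper_gamma c c) <= m^-1.
  rewrite /reg_upper_gamma mulrCA upper_gammaE// -/m.
  have [->|G0] := eqVneq (Gamma_fn c) 0.
    by rewrite mul0r mulr0 invr0 mulr0 lexx invr_ge0.
  rewrite (mulfV G0) mulr1 invfM mulrA mulfV ?gt_eqF ?powR_gt0// mul1r.
  by rewrite lexx invr_ge0 m0.
rewrite -mulrA; apply: ler_pM => //; first by rewrite mulr_ge0.
by rewrite mulrC ler_wpM2l.
Qed.

Section measurability.
Context {d : measure_display} {S : measurableType d}.
Implicit Types f : S -> R.

Lemma measurable_fine_integral (k : S * R -> R) :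
  measurable_fun setT k -> (forall z, 0 <= k z) ->
  measurable_fun setT (fun w => fine (\int[mu]_u (k (w, u))%:E)%E).
Proof.
move=> mk k0; apply: (measurableT_comp (fine_measurable measurableT)).
apply: (measurable_fun_fubini_tonelli_F (m2 := mu) (EFin \o k)).
  exact/measurable_EFinP.
by move=> z; rewrite lee_fin.
Qed.

(** The boolean [b] lets the domain depend on [w], so one Tonelli argument covers both gamma
    functions. *)
Lemma measurable_truncated_gamma (b : S * R -> bool) f :
  measurable_fun setT b -> measurable_fun setT f ->
  measurable_fun setT (fun w =>
    \int[mu]_(u in [set u | b (w, u)]) (u `^ (f w - 1) * expR (- u))).
Proof.
move=> mb mf.
pose k (z : S * R) := if b z then z.2 `^ (f z.1 - 1) * expR (- z.2) else 0.
have -> : (fun w => \int[mu]_(u in [set u | b (w, u)]) (u `^ (f w - 1) * expR (- u))) =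
  (fun w => fine (\int[mu]_u (k (w, u))%:E)%E).
  apply/funext => w; rewrite /Rintegral integral_mkcond; congr fine.
  apply: eq_integral => u _; rewrite patchE /k /=.
  rewrite (_ : (u \in [set u | b (w, u)]) = b (w, u)); last first.
    by apply/idP/idP; rewrite inE.
  by case: ifP.
apply: measurable_fine_integral; last first.
  by move=> z; rewrite /k; case: ifP => // _; rewrite mulr_ge0 ?powR_ge0 ?expR_ge0.
apply: measurable_fun_ifT => //; apply: measurable_funM; last first.
  by apply: measurable_fun_expR; exact: measurable_funN.
apply: measurable_fun_powR => //; apply: measurable_funB => //.
exact: measurableT_comp.
Qed.

Lemma measurable_fun_Gamma_fn f : measurable_fun setT f ->
  measurable_fun setT (fun w => Gamma_fn (f w)).
Proof.
move=> mf; apply: (measurable_truncated_gamma (b := fun z => 0 < z.2)) => //.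
exact: measurable_fun_ltr.
Qed.

Lemma measurable_fun_upper_gamma f g : measurable_fun setT f -> measurable_fun setT g ->
  measurable_fun setT (fun w => upper_gamma (f w) (g w)).
Proof.
move=> mf mg; apply: (measurable_truncated_gamma (b := fun z => g z.1 <= z.2)) => //.
by apply: measurable_fun_ler => //; exact: measurableT_comp.
Qed.

End measurability.

End incomplete_gamma.

(** * The mixture over [lam] and its comparison with the gamma expression *)

Section mixture.
Variables (R : realType) (B theta : R).
Hypothesis B0 : 0 < B.
Local Notation mu := (@lebesgue_measure R).
Local Notation c := (theta / B ^+ 2).

(* Density, in the variable [v = exp (lam * B)], of the unnormalized mixing
   distribution [exp (- theta * bpsi B lam) dlam] on [lam >= 0]. *)
Definition mix_density (v : R) : R :=
  if 1 <= v then expR ((c - 1) * ln v - c * v) else 0.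

Definition mix_kernel (s nu v : R) : R :=
  mix_density v * (coshR (ln v / B * s) * expR (- (nu * bpsi B (ln v / B)))).

Lemma mix_density_ge0 v : 0 <= mix_density v.
Proof. by rewrite /mix_density; case: ifP => // _; exact: expR_ge0. Qed.

Lemma mix_kernel_ge0 s nu v : 0 <= mix_kernel s nu v.
Proof. by rewrite !mulr_ge0 ?mix_density_ge0 ?coshR_ge0 ?expR_ge0. Qed.

Lemma measurable_mix_density : measurable_fun setT mix_density.
Proof.
apply: measurable_fun_ifT => //; first exact: measurable_fun_ler.
by apply: measurable_fun_expR; apply: measurable_funB; apply: measurable_funM.
Qed.

Lemma measurable_mix_kernel (d : measure_display) (S : measurableType d) (s nu : S -> R) :
  measurable_fun setT s -> measurable_fun setT nu ->
  measurable_fun setT (fun z : S * R => mix_kernel (s z.1) (nu z.1) z.2).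
Proof.
move=> ms mnu.
have mlam : measurable_fun setT (fun z : S * R => ln z.2 / B).
  by apply: measurable_funM => //; exact: (measurableT_comp (@measurable_ln R)).
apply: measurable_funM; first exact: (measurableT_comp measurable_mix_density).
apply: measurable_funM.
  by apply: measurable_fun_coshR; apply: measurable_funM => //; exact: measurableT_comp.
apply: measurable_fun_expR; apply: measurable_funN; apply: measurable_funM.
  exact: measurableT_comp.
apply: measurable_funM => //; apply: measurable_funB; last exact: measurable_funM.
apply: measurable_funB => //; apply: measurable_fun_expR; exact: measurable_funM.
Qed.

Definition mixture (s nu : R) : \bar R := (\int[mu]_v (mix_kernel s nu v)%:E)%E.

Lemma mixture_ge0 s nu : (0 <= mixture s nu)%E.
Proof. by apply: integral_ge0 => v _; rewrite lee_fin mix_kernel_ge0. Qed.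

(** The initial value is the total mass of [mix_density]; it accounts for the normalizing factor in
    [c]. *)
Lemma mixture0 : mixture 0 0 = tail_integral c c.
Proof.
rewrite /mixture /tail_integral [RHS]integral_mkcond; apply: eq_integral => v _.
rewrite /mix_kernel mulr0 coshR0 mul0r oppr0 expR0 !mulr1 patchE /mix_density.
by rewrite mem_setE in_itv/= andbT; case: ifP.
Qed.

(* The exponents agree because [v = exp (ln v)]; then [exp x <= 2 cosh x]. *)
Lemma tail_integral_le s nu :
  ((expR (nu / B ^+ 2))%:E *
   tail_integral ((B * s + nu + theta) / B ^+ 2) ((nu + theta) / B ^+ 2) <=
   2%:E * mixture s nu)%E.
Proof.
have Bn0 : B != 0 by rewrite gt_eqF.
have mtail (a x : R) : measurable_fun (`[1%R, +oo[%classic : set R)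
    (fun v : R => (expR ((a - 1) * ln v - x * v))%:E).
  apply/measurable_EFinP; apply: measurable_funTS; apply: measurable_fun_expR.
  by apply: measurable_funB; apply: measurable_funM.
have mk : measurable_fun setT (fun v => mix_kernel s nu v).
  exact: (measurableT_comp (measurable_mix_kernel (S := R) (measurable_cst s)
    (measurable_cst nu)) (pair1_measurable (0 : R))).
rewrite /tail_integral -ge0_integralZl_EFin ?expR_ge0//; last exact: mtail.
rewrite /mixture -ge0_integralZl_EFin//; last 2 first.
- by move=> v _; rewrite lee_fin mix_kernel_ge0.
- exact/measurable_EFinP.
rewrite integral_mkcond; apply: ge0_le_integral => //.
- by move=> v _; rewrite patchE; case: ifP => // _; rewrite mule_ge0// lee_fin expR_ge0.
- apply: (iffLR (measurable_restrictT _ _)) => //.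
  by apply: measurable_funeM; exact: mtail.
- by apply: measurable_funeM; exact/measurable_EFinP.
move=> v _; rewrite patchE mem_setE in_itv/= andbT.
rewrite /mix_kernel /mix_density; case: ifP => [v1|_]; last by rewrite mul0r mule0.
have v0 : 0 < v by exact: lt_le_trans v1.
rewrite -!EFinM lee_fin.
have psiE : bpsi B (ln v / B) = (v - 1 - ln v) / B ^+ 2.
  by rewrite /bpsi divfK// lnK.
set E := expR ((c - 1) * ln v - c * v); set W := expR (- _).
have -> : 2 * (E * (coshR (ln v / B * s) * W)) = E * W * (2 * coshR (ln v / B * s)) by ring.
apply: le_trans (ler_wpM2l _ (expR_le_2coshR _)); last by rewrite mulr_ge0 ?expR_ge0.
rewrite /E /W psiE -!expRD ler_expR le_eqVlt; apply/orP; left; apply/eqP.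
by field.
Qed.

End mixture.

(** * Supermartingale property and maximal inequality for the mixture *)

Section mixture_supermartingale.
Variables (R : realType) (H : lmodType R) (inner : H -> H -> R).
Context {d : measure_display} {T : measurableType d}.
Variables (P : probability T R) (F : nat -> set_system T).
Variables (X : nat -> T -> H) (eps sigma : nat -> T -> R) (B rho theta : R).
Hypothesis hH : is_separable_hilbert inner.
Hypothesis FP : filtration F.
Hypothesis B0 : 0 < B.
Hypothesis hyp : forall t, (0 < t)%N ->
     [/\ Hmeasurable_wrt inner (F t.-1) (X t),
         measurable_wrt (F t) (eps t),
         condexp_zero P (F t.-1) (eps t),
         (forall w, `|eps t w| <= B)
       & condvar_le P (F t.-1) (eps t) (sigma t) /\ measurable_wrt (F t.-1) (sigma t)].
Hypothesis rho0 : 0 < rho.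

Local Notation S t w := (s_t inner rho (fun i => X i w) (fun i => eps i w) t).
Local Notation N t w := (nu_t inner rho (fun i => X i w) (fun i => sigma i w) t).
Local Notation FT t := (g_sigma_algebraType (F t)).
Local Notation mu := (@lebesgue_measure R).

Definition mix_process t w : \bar R := mixture B theta (S t w) (N t w).

Let sF t : sigma_algebra setT (F t). Proof. by case: FP. Qed.
Let Fm t : F t `<=` measurable. Proof. by case: FP. Qed.

Lemma measurable_s_t_T t : measurable_fun setT (fun w => S t w).
Proof.
by apply: (measurable_fun_sub (sF t) (@Fm t)); exact: (measurable_s_t hH FP hyp rho0).
Qed.

Lemma measurable_nu_t_T t : measurable_fun setT (fun w => N t w).
Proof.
apply: (measurable_fun_sub (sF t) (@Fm t)).
exact: (measurable_nu_t hH FP hyp rho0).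
Qed.

Lemma measurable_mix_process t :
  measurable_fun setT (mix_process t : FT t -> \bar R).
Proof.
have mS : measurable_fun setT ((fun w => S t w) : FT t -> R).
  exact: (measurable_s_t hH FP hyp rho0).
have mN : measurable_fun setT ((fun w => N t w) : FT t -> R).
  exact: (measurable_nu_t hH FP hyp rho0).
have mk := measurable_mix_kernel B theta mS mN.
apply: (measurable_fun_fubini_tonelli_F (m2 := mu)
  (fun z : FT t * R => (mix_kernel B theta (S t z.1) (N t z.1) z.2)%:E)).
  exact/measurable_EFinP.
by move=> z; rewrite lee_fin mix_kernel_ge0.
Qed.

(** Tonelli exchanges expectation and mixing, after which each [v >= 1] is an instance of
    [cosh_process_step] at [lam = ln v / B >= 0]. *)
Lemma mix_process_super t A : F t A ->
  (\int[P]_(w in A) mix_process t.+1 w <= \int[P]_(w in A) mix_process t w)%E.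
Proof.
move=> FA; have mA := Fm FA.
have mI : measurable_fun setT (\1_A : T -> R) by exact: measurable_indic.
pose k s (z : T * R) := (\1_A z.1 * mix_kernel B theta (S s z.1) (N s z.1) z.2)%:E.
have k0 s z : (0 <= k s z)%E by rewrite lee_fin mulr_ge0// mix_kernel_ge0.
have mk s : measurable_fun setT (k s).
  apply/measurable_EFinP; apply: measurable_funM; last first.
    exact: (measurable_mix_kernel B theta (@measurable_s_t_T s) (@measurable_nu_t_T s)).
  exact: (measurableT_comp mI measurable_fst).
have fub s : (\int[P]_(w in A) mix_process s w = \int[mu]_v \int[P]_w k s (w, v))%E.
  rewrite -(fubini_tonelli (m1 := P) (m2 := mu) _ (mk s) (k0 s)).
  rewrite integral_mkcond; apply: eq_integral => w _; rewrite patchE /k.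
  case: ifPn => wA.
    by apply: eq_integral => v _; rewrite /= indicE wA mul1r.
  by rewrite integral0_eq// => v _; rewrite /= indicE (negbTE wA) mul0r.
rewrite !fub; apply: ge0_le_integral => //.
- by move=> v _; apply: integral_ge0 => w _; exact: k0.
- exact: (measurable_fun_fubini_tonelli_G (m1 := P) _ (mk _) (k0 _)).
- exact: (measurable_fun_fubini_tonelli_G (m1 := P) _ (mk _) (k0 _)).
move=> v _; have [v1|v1] := leP 1 (v : R); last first.
  rewrite !integral0_eq// => w _; rewrite /k /mix_kernel /mix_density leNgt v1 mul0r mulr0//.
have kE s : (\int[P]_w k s (w, v) = \int[P]_w
    (\1_A w * mix_density B theta v *
     cosh_process inner X eps sigma B rho (ln v / B) s w)%:E)%E.
  by apply: eq_integral => w _; apply: (congr1 EFin); exact: mulrA.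
rewrite !kE; apply: (cosh_process_step hH FP B0 hyp rho0 (Ka := mix_density B theta v)).
- by rewrite divr_ge0 ?ln_ge0// ltW.
- apply/(measurable_wrtP _ (sF t)); apply: measurable_funM => //.
  by apply: measurable_indic; rewrite g_sigma_algebra_measurableE.
- move=> w; have m0 := mix_density_ge0 B theta v.
  by rewrite mulr_ge0//= indicE; case: (_ \in _); rewrite ?mul1r ?mul0r.
Qed.

Lemma mix_process0 w : mix_process 0 w = tail_integral (theta / B ^+ 2) (theta / B ^+ 2).
Proof.
rewrite /mix_process (s_tE hH rho0) /Mt /nu_t !big_nil.
by rewrite (form0l (qform_psd hH rho0 _ _)) sqrtr0 mixture0.
Qed.

Lemma mix_process_ville (k : R) : 0 <= k ->
  (k%:E * P (\bigcup_t [set w | (k%:E <= mix_process t w)%E]) <=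
   tail_integral (theta / B ^+ 2) (theta / B ^+ 2))%E.
Proof.
move=> k0.
have Y0 t w : (0 <= mix_process t w)%E by exact: mixture_ge0.
apply: le_trans (ville FP Y0 measurable_mix_process mix_process_super k0) _.
under eq_integral do rewrite mix_process0.
by rewrite integral_cst//= probability_setT mule1.
Qed.

End mixture_supermartingale.

Theorem theorem4 (R : realType) (H : lmodType R) (inner : H -> H -> R)
  (d : measure_display) (T : measurableType d) (P : probability T R)
  (F : nat -> set_system T) (X : nat -> T -> H) (eps sigma : nat -> T -> R)
  (B rho theta delta : R) :
  is_separable_hilbert inner ->
  filtration F ->
  0 < B ->
  (forall t, (0 < t)%N ->
     [/\ Hmeasurable_wrt inner (F t.-1) (X t),
         measurable_wrt (F t) (eps t),
         condexp_zero P (F t.-1) (eps t),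
         (forall w, `|eps t w| <= B)
       & condvar_le P (F t.-1) (eps t) (sigma t) /\ measurable_wrt (F t.-1) (sigma t)]) ->
  0 < rho -> 0 < theta -> 0 < delta < 1 ->
  let c := theta / B ^+ 2 in
  let Phi := fun w t =>
    let s := s_t inner rho (fun i => X i w) (fun i => eps i w) t in
    let nu := nu_t inner rho (fun i => X i w) (fun i => sigma i w) t in
    let a := (B * s + nu + theta) / B ^+ 2 in
    let x := (nu + theta) / B ^+ 2 in
    c `^ c / (Gamma_fn c * reg_upper_gamma c c)
    * (Gamma_fn a * reg_upper_gamma a x / x `^ a)
    * expR (nu / B ^+ 2) in
  (P [set w | ereal_sup [set (Phi w t)%:E | t in [set t : nat | (0 < t)%N]]
                < (2 / delta)%:E] >= (1 - delta)%:E)%E.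
Proof.
move=> hH FP B0 hyp rho0 theta0 /andP[delta0 delta1].
pose c := theta / B ^+ 2.
pose S t w := s_t inner rho (fun i => X i w) (fun i => eps i w) t.
pose N t w := nu_t inner rho (fun i => X i w) (fun i => sigma i w) t.
pose a t w := (B * S t w + N t w + theta) / B ^+ 2.
pose x t w := (N t w + theta) / B ^+ 2.
pose Phi w t := c `^ c / (Gamma_fn c * reg_upper_gamma c c)
  * (Gamma_fn (a t w) * reg_upper_gamma (a t w) (x t w) / x t w `^ a t w)
  * expR (N t w / B ^+ 2).
pose E := [set w | (ereal_sup [set (Phi w t)%:E | t in [set t : nat | (0 < t)%N]]
                < (2 / delta)%:E)%E].
suff : ((1 - delta)%:E <= P E)%E by [].
pose Y t w := mixture B theta (S t w) (N t w).
have B20 : 0 < B ^+ 2 by rewrite exprn_gt0.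
have c0 : 0 < c by rewrite divr_gt0.
have N0 t w : 0 <= N t w by exact: nu_t_ge0.
have mS t : measurable_fun setT (S t) by exact: (measurable_s_t_T hH FP hyp rho0).
have mN t : measurable_fun setT (N t) by exact: (measurable_nu_t_T hH FP hyp rho0).
have mPhi t : measurable_fun setT (fun w => (Phi w t)%:E).
  have ma : measurable_fun setT (a t).
    apply: measurable_funM => //; apply: measurable_funD => //.
    by apply: measurable_funD => //; apply: measurable_funM.
  have mx : measurable_fun setT (x t).
    by apply: measurable_funM => //; exact: measurable_funD.
  have mG := measurable_fun_Gamma_fn ma.
  apply/measurable_EFinP; apply: measurable_funM; last first.
    by apply: measurable_fun_expR; exact: measurable_funM.
  apply: measurable_funM => //; apply: measurable_funM; last first.
    apply: measurable_fun_inv; first exact: measurable_fun_powR.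
    by move=> w; exact: powR_ge0.
  apply: measurable_funM => //; apply: measurable_funM.
    exact: measurable_fun_upper_gamma.
  by apply: measurable_fun_inv => // w; exact: Gamma_fn_ge0.
(* Passing to the complement requires a measurable event; [esups] from index 1 is the supremum over
   [t > 0]. *)
have mE : measurable E.
  have := measurable_fun_esups mPhi 1 => msup.
  by rewrite -[X in measurable X]setTI; exact: emeasurable_fun_infty_o.
pose m := fine (tail_integral c c).
have m0 : 0 <= m by apply: fine_ge0; exact: tail_integral_ge0.
have PhiB w t : Phi w t <= m^-1 *
    (expR (N t w / B ^+ 2) * fine (tail_integral (a t w) (x t w))).
  by apply: gamma_ratio_le => //; rewrite ?expR_ge0 ?divr_gt0 ?ltr_wpDl.
suff PE : (P (~` E) <= delta%:E)%E.
  have -> : P E = (1 - P (~` E))%E.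
    by rewrite -probability_setC ?setCK//; exact: measurableC.
  by rewrite EFinB leeB.
(* If [m = 0] then [m^-1 = 0] and every [Phi w t] is at most 0, so the event is certain. An infinite
   [tail_integral c c] falls under this case. *)
have [m00|mN0] := eqVneq m 0.
  suff -> : E = setT by rewrite setCT measure0 lee_fin ltW.
  apply/seteqP; split=> // w _; rewrite /E/=.
  apply: (@le_lt_trans _ _ 0%E); last by rewrite lte_fin divr_gt0.
  apply: ge_ereal_sup => _ [t _ <-]; rewrite lee_fin.
  by apply: le_trans (PhiB w t) _; rewrite m00 invr0 mul0r.
have m_gt0 : 0 < m by rewrite lt_def mN0.
have tailE : tail_integral c c = m%:E.
  rewrite /m fineK//; move: m_gt0; rewrite /m.
  by have := tail_integral_ge0 c c; case: (tail_integral c c) => //=; rewrite ltxx.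
have PhiY w t : ((m * Phi w t)%:E <= 2%:E * Y t w)%E.
  have h := tail_integral_le theta B0 (S t w) (N t w).
  apply: le_trans h; rewrite -/(a t w) -/(x t w); set J := tail_integral _ _.
  apply: (@le_trans _ _ ((expR (N t w / B ^+ 2))%:E * (fine J)%:E)%E).
    rewrite -EFinM lee_fin -ler_pdivlMl//; exact: PhiB.
  apply: lee_wpmul2l; first by rewrite lee_fin expR_ge0.
  have := tail_integral_ge0 (a t w) (x t w).
  by rewrite -/J; case: J => //= _; rewrite leey.
have PEfin : P (~` E) \is a fin_num by apply: fin_num_measure; exact: measurableC.
rewrite -(fineK PEfin) lee_fin.
have p1 : fine (P (~` E)) <= 1.
  by rewrite -lee_fin fineK//; apply: probability_le1; exact: measurableC.
(* Outside [E] the supremum is at least [2 / delta] but need not be attained, so Ville is applied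
   just below the level [m / delta]. Capping the slack [e'] at [delta^-1] keeps that level
   non-negative. *)
rewrite -[leRHS]mul1r -ler_pdivrMr//; apply/ler_addgt0Pr => e e0.
pose e' := Num.min e (delta^-1).
have e'0 : 0 < e' by rewrite lt_min e0 invr_gt0.
have e'e : e' <= e by rewrite ge_min lexx.
have k0 : 0 <= delta^-1 - e' by rewrite subr_ge0 ge_min lexx orbT.
have := mix_process_ville theta hH FP B0 hyp rho0 (mulr_ge0 m0 k0).
rewrite -/c tailE => vi.
have EY : ~` E `<=` \bigcup_t [set w | ((m * (delta^-1 - e'))%:E <= Y t w)%E].
  move=> w; rewrite /E /setC/= => /negP; rewrite -leNgt => supge.
  have /ereal_sup_gt : ((2 * (delta^-1 - e'))%:E <
      ereal_sup [set (Phi w t)%:E | t in [set t : nat | (0 < t)%N]])%E.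
    by apply: lt_le_trans supge; rewrite lte_fin; lra.
  move=> [_ [t _ <-]]; rewrite lte_fin => Phigt; exists t => //=.
  rewrite -(@lee_pmul2l _ 2%:E) ?lte_fin//; apply: le_trans (PhiY w t).
  rewrite -EFinM lee_fin mulrCA ler_pM2l//; exact: ltW.
have mU : measurable (\bigcup_t [set w | ((m * (delta^-1 - e'))%:E <= Y t w)%E]).
  apply: bigcup_measurable => t _; rewrite -[X in measurable X]setTI.
  apply: emeasurable_fun_c_infty => //.
  have [sF Fm _] := FP; apply: (measurable_fun_sub (sF t) (Fm t)).
  exact: (measurable_mix_process theta hH FP hyp rho0).
have : (m * (delta^-1 - e')) * fine (P (~` E)) <= m.
  rewrite -lee_fin EFinM fineK//; apply: le_trans vi.
  apply: lee_wpmul2l; first by rewrite lee_fin mulr_ge0.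
  by apply: le_measure => //; rewrite inE//; exact: measurableC.
rewrite -mulrA ger_pMr// => h.
have pf0 : 0 <= fine (P (~` E)) by exact: fine_ge0.
have : e' * fine (P (~` E)) <= e by apply: le_trans e'e; rewrite ler_piMr// ltW.
by rewrite mulrC; move: h; rewrite mulrBl; lra.
Qed.
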